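(* Let $p$ be a prime, let $H>0$, and let $\{X_n\}_{n\in\mathbb{N}_0}$ be a stochastic process satisfying $\mathbb{E}(|X_1|^2)<\infty$. Then $\{X_n\}_{n\in\mathbb{N}_0}$ is dt-ss-si of type II with scaling function $b(n)=(|n|_p)^H$ if and only if $$X_n=\sum_{m=1}^\infty\ \sum_{0<\ell<p^m,\ p\nmid \ell}A^{(m)}_\ell\left(e\left(\frac{n\ell}{p^m}\right)-1\right),\quad n\in\mathbb{N}_0,$$ in the sense of convergence in $L^2(\Omega,\mathcal F,\mathbb P)$, where $\{A^{(m)}_\ell\}_{m\in\mathbb{N},\,0<\ell<p^m,\,p\nmid \ell}$ is an orthogonal sequence in $L^2(\Omega,\mathcal F,\mathbb P)$ satisfying: (1) $$\{A^{(m)}_\ell\}_{m\in\mathbb{N},0<\ell<p^m,p\nmid \ell}\overset{d}{=}\left\{e\left(\frac{\ell}{p^m}\right)A^{(m)}_\ell\right\}_{m\in\mathbb{N},0<\ell<p^m,p\nmid \ell};$$ (2) for every prime $q\neq p$, $$\{A_\ell^{(m)}\}_{m\in\mathbb{N},0<\ell<p^m,p\nmid \ell}\overset{d}{=}\{A_{[q\ell]}^{(m)}\}_{m\in\mathbb{N},0<\ell<p^m,p\nmid \ell},$$ where $[q\ell]$ is the residue of $q\ell$ modulo $p^m$; (3) $$\{p^{-H}A_\ell^{(m)}\}_{m\in\mathbb{N},0<\ell<p^m,p\nmid \ell}\overset{d}{=}\left\{\sum_{t=0}^{p-1}A_{tp^m+\ell}^{(m+1)}\right\}_{m\in\mathbb{N},0<\ell<p^m,p\nmid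 \ell}.$$
   Context: $\mathbb{N}=\{1,2,\dots\}$, $\mathbb{N}_0=\{0,1,2,\dots\}$; $\overset{d}{=}$ denotes equality in distribution (of the whole families, jointly). $e(x)=e^{i2\pi x}$. $|n|_p=p^{-v_p(n)}$ is the $p$-adic norm. $(\Omega,\mathcal F,\mathbb P)$ is the underlying probability space, and $L^2(\Omega,\mathcal F,\mathbb P)$ is the space of complex-valued square-integrable random variables; orthogonal means $\mathbb{E}(A\overline{A'})=0$ for any two members with different indices. The process $\{X_n\}$ is real-valued. A real-valued process $\{X_m\}_{m\in\mathbb{N}_0}$ is dt-ss-si with scaling function $b:\mathbb N\to(0,\infty)$ if $\{X_{nm}\}_{m\in\mathbb{N}_0}\overset{d}{=}\{b(n)X_m\}_{m\in\mathbb{N}_0}$ for every $n\in\mathbb{N}$, and $\{X_{m+1}-X_m\}_{m\in\mathbb{N}_0}\overset{d}{=}\{X_{m+k+1}-X_{m+k}\}_{m\in\mathbb{N}_0}$ for every $k\in\mathbb{N}$. Type II means that the scaling function is $(|n|_p)^H$ for a prime $p$ and $H>0$. *)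

(* Defs.v *)
From HB Require Import structures.
From mathcomp Require Import all_boot all_order all_algebra.
From mathcomp Require Import complex.
From mathcomp Require Import all_classical all_reals all_analysis.

Set Implicit Arguments.
Unset Strict Implicit.
Unset Printing Implicit Defensive.

Import Order.TTheory GRing.Theory Num.Theory.
Import numFieldNormedType.Exports.
Import ComplexField.Normc.

Local Open Scope classical_set_scope.
Local Open Scope ring_scope.

Section equality_in_distribution.
Context d d' (T : measurableType d) (V : measurableType d') (R : realType).

Definition cylinders (I : Type) : set (set (I -> V)) :=
  [set C | exists (i : I) (B : set V),
     measurable B /\ C = [set f : I -> V | B (f i)]].

(* The laws of the two families coincide on the product sigma-algebra of
   [I -> V], i.e. the families have the same joint distribution. *)
Definition eq_dist (P : probability T R) (I : Type) (Y Z : I -> T -> V) : Prop :=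
  forall C : set (I -> V), <<s @cylinders I >> C ->
    P [set w | C (Y^~ w)] = P [set w | C (Z^~ w)].

End equality_in_distribution.

Section complex_random_variables.
Context d (T : measurableType d) (R : realType).
Implicit Types (P : probability T R) (A B : T -> R[i]).

(* R[i] carries no sigma-algebra in the library; its Borel sigma-algebra is that
   of R * R through this identification. *)
Definition pair_of_complex (z : R[i]) : measurableTypeR R * measurableTypeR R :=
  (complex.Re z, complex.Im z).

Definition complex_RV A : Prop :=
  measurable_fun [set: T] (fun w => pair_of_complex (A w)).

Definition complex_L2 P A : Prop :=
  complex_RV A /\ ('E_P[fun w => (normc (A w) ^+ 2)%R] < +oo)%E.

Definition complex_expectation P A : R[i] :=
  Complex (fine 'E_P[fun w => complex.Re (A w)]%E)
          (fine 'E_P[fun w => complex.Im (A w)]%E).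

Definition complex_eq_dist P (I : Type) (Y Z : I -> T -> R[i]) : Prop :=
  eq_dist P (fun i w => pair_of_complex (Y i w))
            (fun i w => pair_of_complex (Z i w)).

Definition cvg_L2 P (S : nat -> T -> R[i]) (Y : T -> R[i]) : Prop :=
  (fun M : nat => 'E_P[fun w => (normc (S M w - Y w) ^+ 2)%R]%E) @ \oo --> 0%E.

End complex_random_variables.

Section dt_ss_si.
Context d (T : measurableType d) (R : realType).

(* [b] is a function on the positive integers; its value at 0 is irrelevant. *)
Definition dt_ss_si (P : probability T R) (b : nat -> R)
    (X : nat -> T -> measurableTypeR R) : Prop :=
  [/\ forall n, (0 < n)%N -> 0 < b n,
      forall n, (0 < n)%N ->
        eq_dist P (fun m w => X (n * m)%N w) (fun m w => b n * X m w)
    & forall k, (0 < k)%N ->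
        eq_dist P (fun m w => X m.+1 w - X m w)
                  (fun m w => X (m + k).+1 w - X (m + k)%N w)].

(* Only meant for [n > 0]: [logn p 0 = 0], so this gives 1 instead of 0 at 0. *)
Definition padic_norm (p n : nat) : R := p%:R ^- logn p n.

End dt_ss_si.

Definition e_ {R : realType} (x : R) : R[i] :=
  Complex (cos (2 * pi * x)) (sin (2 * pi * x)).

(* The pairs (m, l) with m >= 1, 0 < l < p ^ m and p not dividing l. *)
Definition spectral_index (p : nat) : Type :=
  {ml : nat * nat |
    [&& 0 < ml.1, 0 < ml.2, ml.2 < p ^ ml.1 & ~~ (p %| ml.2)]%N}.

Section spectral_sequence.
Context d (T : measurableType d) (R : realType).
(* [A m l] stands for A^(m)_l and is only constrained at indices (m, l) in
   [spectral_index p]; the other values are never used. *)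
Implicit Types (A : nat -> nat -> T -> R[i]).

Definition on_index (p : nat) A : spectral_index p -> T -> R[i] :=
  fun i => A (val i).1 (val i).2.

Definition orthogonal_L2 (P : probability T R) (I : Type)
    (Y : I -> T -> R[i]) : Prop :=
  (forall i, complex_L2 P (Y i)) /\
  (forall i j, i <> j ->
    complex_expectation P (fun w => Y i w * conjc (Y j w)) = 0).

Definition partial_expansion (p : nat) A (n M : nat) (w : T) : R[i] :=
  \sum_(1 <= m < M.+1) \sum_(1 <= l < p ^ m | ~~ (p %| l)%N)
    A m l w * (e_ ((n * l)%:R / (p ^ m)%:R : R) - 1).

End spectral_sequence.

Arguments on_index {d T R} p A.

(* Main.v *)
Require Import Defs.
From HB Require Import structures.
From mathcomp Require Import all_boot all_order all_algebra.
From mathcomp Require Import complex.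
From mathcomp Require Import all_classical all_reals all_analysis.
From mathcomp Require Import measurable_realfun ring lra zify.

(** Why the theorem is true.  A process of type II lives on the p-adic integers.
    Stationary increments and scaling give, for y and z congruent modulo p ^ M,
    E|X_y - X_z|^2 <= p^(-2HM) E|X_1|^2 (lemma [sqn_close]), so n |-> X_n is
    uniformly continuous from the p-adic metric to L^2 and has Fourier
    coefficients on the compact group Z_p,
<<
      A^(m)_l = integral over y in Z_p of X_y e(- y l / p^m),
>>
    which are the mean square limits of the averages of X_y e(- y l / p^m) over
    y < p^N ([fourier], [fourier_limit]).  The three invariances of the spectral
    sequence are the images under the Fourier transform of three invariances of
    the law of X: the translation n |-> n + 1 becomes the rotation by e(l / p^m)
    ([spectrum_rotation]), the multiplication of n by a prime q <> p becomes the
    multiplication of frequencies ([spectrum_multiplication]), and the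
    multiplication of n by p becomes the sum over the p frequencies of the next
    level that lie above a given one ([spectrum_trace]).  Orthogonality follows
    from the rotation invariance: E (A_i conj A_j) is multiplied by a number
    different from 1, hence vanishes ([spectrum_orthogonal]).  The expansion is
    finite Fourier inversion: its partial sum of order M is the average of X over
    n + p^M Z_p minus the average over p^M Z_p ([fourier_inversion]), and tends to
    X_n - X_0, where X_0 = 0 almost surely because its law is invariant under
    the contraction p^(-H) ([contracting_law_ae0]).

    Conversely, in the expansion of the increments, of X_{q n} and of X_{p n}, the
    change of n can be moved to the coefficients, where the three invariances
    absorb it; the general scaling relation follows by factoring n into primes
    ([stationary_increments_of_spectrum], [scaling_of_spectrum]).

    Both directions compare the joint laws of two families of mean square
    limits, knowing that the approximating families, over all indices and all
    orders of approximation together, have the same law.  Lemma [eq_dist_cvg_L2]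
    does this once and for all: along one subsequence that converges fast for
    both families, every limit is almost surely the same measurable functional, a
    limit superior, of the approximants.  The L^2 estimates rest on
    |a + b|^2 <= 2|a|^2 + 2|b|^2 and the convexity of the square
    ([sqn_mean]). *)

Set Implicit Arguments.
Unset Strict Implicit.
Unset Printing Implicit Defensive.

Import Order.TTheory GRing.Theory Num.Theory.
Import numFieldNormedType.Exports.
Import ComplexField.Normc.

Local Open Scope classical_set_scope.
Local Open Scope ring_scope.

(** * Joint laws of families *)

Section laws_of_families.
Context d d' (T : measurableType d) (V : measurableType d').

Lemma measurable_coordinate (I : Type) (i : I) :
  measurable_fun setT
    ((fun f => f i) : g_sigma_algebraType (@cylinders _ V I) -> V).
Proof.
move=> _ B mB; rewrite setTI; apply: sub_sigma_algebra.
by exists i, B.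
Qed.

Lemma measurable_family (I : Type) (Y : I -> T -> V) :
  (forall i, measurable_fun setT (Y i)) ->
  measurable_fun setT
    ((fun w => Y^~ w) : T -> g_sigma_algebraType (@cylinders _ V I)).
Proof.
move=> mY; apply: (@measurability _ _ T (g_sigma_algebraType (@cylinders _ V I)) _ _
  (@cylinders _ V I)) => //.
by move=> _ [_ [i [B [mB ->]]] <-]; apply: mY.
Qed.

End laws_of_families.

Section eq_dist_transfer.
Context d d' d'' (T : measurableType d) (V : measurableType d')
  (W : measurableType d'') (R : realType) (P : probability T R).

(** The workhorse for moving equalities of laws: a measurable transformation of
    the whole family, each output of which may depend on all inputs, preserves
    them. *)
Lemma eq_dist_map (I J : Type) (F : J -> (I -> V) -> W) (Y Z : I -> T -> V) :
  (forall j, measurable_fun setT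
     (F j : g_sigma_algebraType (@cylinders _ V I) -> W)) ->
  eq_dist P Y Z ->
  eq_dist P (fun j w => F j (Y^~ w)) (fun j w => F j (Z^~ w)).
Proof.
move=> mF YZ C mC.
have := measurable_family mF measurableT mC; rewrite setTI => mFC.
exact: (YZ _ mFC).
Qed.

(** Countability of the index set is essential: an event of the product
    sigma-algebra may involve all the entries at once, so the entries must agree
    off a single null set. *)
Lemma eq_dist_ae (I : countType) (Y Z Y' Z' : I -> T -> V) :
  (forall i, measurable_fun setT (Y i)) ->
  (forall i, measurable_fun setT (Z i)) ->
  (forall i, measurable_fun setT (Y' i)) ->
  (forall i, measurable_fun setT (Z' i)) ->
  (forall i, \forall w \ae P, Y i w = Y' i w) ->
  (forall i, \forall w \ae P, Z i w = Z' i w) ->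
  eq_dist P Y Z -> eq_dist P Y' Z'.
Proof.
have ae_law (U U' : I -> T -> V) : (forall i, measurable_fun setT (U i)) ->
    (forall i, measurable_fun setT (U' i)) ->
    (forall i, \forall w \ae P, U i w = U' i w) ->
    forall C, <<s @cylinders _ V I >> C ->
    P [set w | C (U^~ w)] = P [set w | C (U'^~ w)].
  move=> mU mU' UU' C mC.
  have aeU : \forall w \ae P, forall i, U i w = U' i w.
    have : \forall w \ae P, forall n, forall i, unpickle n = Some i ->
        U i w = U' i w.
      apply: ae_foralln => n; case: (unpickle n) => [i|]; last by apply: aeW.
      by apply: filterS (UU' i) => w Ew j [<-].
    by apply: filterS => w Ew i; apply: (Ew (pickle i)); rewrite pickleK.
  have m1 := measurable_family mU measurableT mC.
  have m2 := measurable_family mU' measurableT mC.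
  rewrite !setTI in m1 m2.
  have PE A : measurable A -> P A = (\int[P]_w (\1_A w)%:E)%E.
    by move=> mA; rewrite integral_indic// setIT.
  rewrite !PE//.
  apply: ae_eq_integral => //; [exact/measurable_EFinP/measurable_indic..|].
  apply: filterS aeU => w Ew _; congr (_%:E); rewrite !indicE.
  have EU : U^~ w = U'^~ w by exact/funext.
  by congr (nat_of_bool _)%:R; apply/idP/idP; rewrite !inE /= EU.
move=> mY mZ mY' mZ' YY' ZZ' YZ C mC.
by rewrite -(ae_law Y Y')// -(ae_law Z Z')//; apply: YZ.
Qed.

End eq_dist_transfer.

(** * Complex random variables *)

Section complex_random_variables_theory.
Context d (S : measurableType d) (R : realType).
Implicit Types A B : S -> R[i].

Lemma normc_sqr (z : R[i]) :
  normc z ^+ 2 = complex.Re z ^+ 2 + complex.Im z ^+ 2.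
Proof. by case: z => a b /=; rewrite sqr_sqrtr// addr_ge0// sqr_ge0. Qed.

Lemma normc_sqr_ge0 (z : R[i]) : 0 <= normc z ^+ 2.
Proof. exact: sqr_ge0. Qed.

Lemma ReD (x y : R[i]) : complex.Re (x + y) = complex.Re x + complex.Re y.
Proof. by case: x y => ? ? []. Qed.
Lemma ImD (x y : R[i]) : complex.Im (x + y) = complex.Im x + complex.Im y.
Proof. by case: x y => ? ? []. Qed.
Lemma ReM (x y : R[i]) : complex.Re (x * y) =
  complex.Re x * complex.Re y - complex.Im x * complex.Im y.
Proof. by case: x y => ? ? []. Qed.
Lemma ImM (x y : R[i]) : complex.Im (x * y) =
  complex.Re x * complex.Im y + complex.Im x * complex.Re y.
Proof. by case: x y => ? ? []. Qed.

Lemma complex_RVP A : complex_RV A <->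
  measurable_fun setT (fun w => complex.Re (A w)) /\
  measurable_fun setT (fun w => complex.Im (A w)).
Proof. exact: measurable_fun_pairP. Qed.

Lemma complex_RV_cst (z : R[i]) : complex_RV (fun _ : S => z).
Proof. exact: measurable_cst. Qed.

Lemma complex_RV_real (f : S -> R) :
  measurable_fun setT f -> complex_RV (fun w => Complex (f w) 0).
Proof. by move=> mf; apply/complex_RVP; split. Qed.

Lemma complex_RVD A B :
  complex_RV A -> complex_RV B -> complex_RV (fun w => A w + B w).
Proof.
move=> /complex_RVP[rA iA] /complex_RVP[rB iB]; apply/complex_RVP; split.
- by under eq_fun do rewrite ReD; exact: measurable_funD.
- by under eq_fun do rewrite ImD; exact: measurable_funD.
Qed.

Lemma complex_RVM A B :
  complex_RV A -> complex_RV B -> complex_RV (fun w => A w * B w).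
Proof.
move=> /complex_RVP[rA iA] /complex_RVP[rB iB]; apply/complex_RVP; split.
- under eq_fun do rewrite ReM.
  by apply: measurable_funB; apply: measurable_funM.
- under eq_fun do rewrite ImM.
  by apply: measurable_funD; apply: measurable_funM.
Qed.

Lemma complex_RV_conj A : complex_RV A -> complex_RV (fun w => conjc (A w)).
Proof.
move=> /complex_RVP[rA iA]; apply/complex_RVP; split.
- by rewrite (_ : (fun _ => _) = fun w => complex.Re (A w))//; apply/funext=> w; case: (A w).
- rewrite (_ : (fun _ => _) = fun w => - complex.Im (A w)); first exact: measurableT_comp.
  by apply/funext=> w; case: (A w).
Qed.

Lemma complex_RVZ z A : complex_RV A -> complex_RV (fun w => z * A w).
Proof. by move=> mA; apply: complex_RVM => //; exact: complex_RV_cst. Qed.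

Lemma complex_RVB A B :
  complex_RV A -> complex_RV B -> complex_RV (fun w => A w - B w).
Proof.
move=> mA mB; under eq_fun do rewrite -mulN1r.
by apply: complex_RVD => //; exact: complex_RVZ.
Qed.

Lemma complex_RV_sum (I : Type) (s : seq I) (Q : pred I) (F : I -> S -> R[i]) :
  (forall i, Q i -> complex_RV (F i)) ->
  complex_RV (fun w => \sum_(i <- s | Q i) F i w).
Proof.
move=> mF; elim: s => [|i s IH].
  by under eq_fun do rewrite big_nil; exact: complex_RV_cst.
under eq_fun do rewrite big_cons; case: (boolP (Q i)) => // Qi.
by apply: complex_RVD => //; exact: mF.
Qed.

Lemma measurable_normc_sqr A :
  complex_RV A -> measurable_fun setT (fun w => normc (A w) ^+ 2).
Proof.
move=> /complex_RVP[rA iA]; under eq_fun do rewrite normc_sqr.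
by apply: measurable_funD; exact: measurable_funX.
Qed.

End complex_random_variables_theory.

Section complex_families.
Context d (T : measurableType d) (R : realType) (P : probability T R).

Definition complex_of_pair (z : measurableTypeR R * measurableTypeR R) : R[i] :=
  Complex z.1 z.2.

Lemma pair_of_complexK (z : R[i]) : complex_of_pair (pair_of_complex z) = z.
Proof. by case: z. Qed.

(** The space of complex families, with the sigma-algebra on which [eq_dist]
    compares laws; [entry] reads its coordinates back as complex numbers. *)
Definition complex_space (I : Type) :=
  g_sigma_algebraType
    (@cylinders _ (measurableTypeR R * measurableTypeR R)%type I).

Definition entry (I : Type) (i : I) (f : complex_space I) : R[i] :=
  complex_of_pair (f i).

Lemma complex_RV_entry (I : Type) (i : I) : complex_RV (entry i).
Proof.
rewrite /complex_RV (_ : (fun _ => _) = fun f => f i).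
  exact: measurable_coordinate.
by apply/funext => f; rewrite /entry /complex_of_pair /pair_of_complex/= -surjective_pairing.
Qed.

(** [eq_dist_map] for functionals written with complex arithmetic, whose
    measurability is then proved by the closure lemmas for [complex_RV]. *)
Lemma complex_eq_dist_map (I J : Type) (F : J -> (I -> R[i]) -> R[i])
    (Y Z : I -> T -> R[i]) :
  (forall j, complex_RV (fun f : complex_space I => F j (fun i => entry i f))) ->
  complex_eq_dist P Y Z ->
  complex_eq_dist P (fun j w => F j (Y^~ w)) (fun j w => F j (Z^~ w)).
Proof.
move=> mF YZ.
pose G (j : J) (f : I -> measurableTypeR R * measurableTypeR R) :=
  pair_of_complex (F j (fun i => complex_of_pair (f i))).
have := @eq_dist_map _ _ _ T _ _ R P I J G _ _ mF YZ.
rewrite /complex_eq_dist /G.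
have E (U : I -> T -> R[i]) : (fun i w => pair_of_complex (F i
    (fun i0 => complex_of_pair (pair_of_complex (U i0 w))))) =
    fun i w => pair_of_complex (F i (U^~ w)).
  apply/funext => j; apply/funext => w; congr (pair_of_complex (F j _)).
  by apply/funext => i; rewrite pair_of_complexK.
by rewrite !E.
Qed.

Lemma complex_eq_dist_sym (I : Type) (Y Z : I -> T -> R[i]) :
  complex_eq_dist P Y Z -> complex_eq_dist P Z Y.
Proof. by move=> YZ C mC; rewrite YZ. Qed.

Lemma complex_eq_dist_trans (I : Type) (Y Z U : I -> T -> R[i]) :
  complex_eq_dist P Y Z -> complex_eq_dist P Z U -> complex_eq_dist P Y U.
Proof. by move=> YZ ZU C mC; rewrite YZ// ZU. Qed.

Lemma complex_eq_dist_ae (I : countType) (Y Z Y' Z' : I -> T -> R[i]) :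
  (forall i, complex_RV (Y i)) -> (forall i, complex_RV (Z i)) ->
  (forall i, complex_RV (Y' i)) -> (forall i, complex_RV (Z' i)) ->
  (forall i, \forall w \ae P, Y i w = Y' i w) ->
  (forall i, \forall w \ae P, Z i w = Z' i w) ->
  complex_eq_dist P Y Z -> complex_eq_dist P Y' Z'.
Proof.
move=> mY mZ mY' mZ' YY' ZZ'; apply: eq_dist_ae => // i.
- by apply: filterS (YY' i) => w ->.
- by apply: filterS (ZZ' i) => w ->.
Qed.

(** Real processes are treated as complex ones with zero imaginary part, so
    that a single calculus of laws and mean squares serves the process and its
    coefficients. *)
Lemma complex_eq_distP (I : Type) (Y Z : I -> T -> measurableTypeR R) :
  eq_dist P Y Z <->
  complex_eq_dist P (fun i w => Complex (Y i w) 0) (fun i w => Complex (Z i w) 0).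
Proof.
split=> YZ.
- apply: (@eq_dist_map _ _ _ T _ _ R P I I
    (fun i (f : I -> measurableTypeR R) => (f i, 0 : measurableTypeR R))) YZ => j.
  by apply: measurable_fun_pair => //; exact: measurable_coordinate.
- have := @eq_dist_map _ _ _ T _ _ R P I I (fun i f => (f i).1) _ _ _ YZ.
  apply=> j; apply: (measurableT_comp measurable_fst); exact: measurable_coordinate.
Qed.

End complex_families.

(** * The mean square *)

Section sum_of_squares.
Context (R : realType).

(** Cauchy-Schwarz against the constant sequence 1, by induction on [n]. *)
Lemma sqr_sum_le (n : nat) (a : nat -> R) :
  (\sum_(0 <= y < n) a y) ^+ 2 <= n%:R * \sum_(0 <= y < n) a y ^+ 2.
Proof.
elim: n => [|n IH]; first by rewrite !big_geq// expr0n mul0r.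
rewrite !big_nat_recr//=.
set s := \sum_(0 <= i < n) a i in IH *; set q := \sum_(0 <= i < n) _ in IH *.
have [n0|n0] := posnP n.
  have -> : s = 0 by rewrite /s n0 big_geq.
  have -> : q = 0 by rewrite /q n0 big_geq.
  by rewrite n0 !add0r mul1r.
have nR : (0 : R) < n%:R by rewrite ltr0n.
rewrite -(ler_pM2l nR) -natr1.
have : 0 <= (s - n%:R * a n) ^+ 2 by exact: sqr_ge0.
move: (n%:R : R) (a n) nR IH => N b N0 IH.
have : (N + 1) * s ^+ 2 <= (N + 1) * (N * q) by rewrite ler_wpM2l// ltW// ltr_wpDr.
nra.
Qed.

(** Arithmetic-geometric mean; it turns summability of weighted squares into
    absolute summability. *)
Lemma le_add_sqr_div (s t q : R) : 0 < s -> 0 <= t -> t ^+ 2 <= q ->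
  t <= s + s^-1 * q.
Proof.
move=> s0 t0 tq; rewrite -(ler_pM2l s0) mulrDr mulVKf ?gt_eqF//.
have := sqr_ge0 (s - t); nra.
Qed.

Lemma Re_sum (I : Type) (s : seq I) (Q : pred I) (F : I -> R[i]) :
  complex.Re (\sum_(i <- s | Q i) F i) = \sum_(i <- s | Q i) complex.Re (F i).
Proof. exact: (big_morph _ (@ReD R) erefl). Qed.
Lemma Im_sum (I : Type) (s : seq I) (Q : pred I) (F : I -> R[i]) :
  complex.Im (\sum_(i <- s | Q i) F i) = \sum_(i <- s | Q i) complex.Im (F i).
Proof. exact: (big_morph _ (@ImD R) erefl). Qed.

Lemma normc_sqr_sum_le (n : nat) (z : nat -> R[i]) :
  normc (\sum_(0 <= y < n) z y) ^+ 2 <=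
  n%:R * \sum_(0 <= y < n) normc (z y) ^+ 2.
Proof.
rewrite normc_sqr Re_sum Im_sum.
under [X in _ <= _ * X]eq_bigr do rewrite normc_sqr.
by rewrite big_split/= mulrDr lerD// sqr_sum_le.
Qed.

Lemma normc_sqrD_le (x y : R[i]) :
  normc (x + y) ^+ 2 <= 2 * normc x ^+ 2 + 2 * normc y ^+ 2.
Proof.
rewrite !normc_sqr ReD ImD.
move: (complex.Re x) (complex.Re y) (complex.Im x) (complex.Im y) => a b c e.
have := sqr_ge0 (a - b); have := sqr_ge0 (c - e); nra.
Qed.

End sum_of_squares.

Section square_norm.
Context d (T : measurableType d) (R : realType) (P : probability T R).
Implicit Types A B : T -> R[i].
Local Open Scope ereal_scope.

(** The squared L^2 norm, infinite when the variable is not square-integrable. *)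
Definition sqn A : \bar R := \int[P]_w (normc (A w) ^+ 2)%:E.

Lemma sqnE A : 'E_P[fun w => (normc (A w) ^+ 2)%R] = sqn A.
Proof. by rewrite unlock. Qed.

Lemma sqn_ge0 A : 0 <= sqn A.
Proof. by apply: integral_ge0 => w _; rewrite lee_fin normc_sqr_ge0. Qed.

Lemma measurable_EFin_normc_sqr A :
  complex_RV A -> measurable_fun setT (fun w => (normc (A w) ^+ 2)%:E).
Proof. by move=> mA; apply/measurable_EFinP; exact: measurable_normc_sqr. Qed.

Lemma sqn_ae A B : complex_RV A -> complex_RV B ->
  (\forall w \ae P, A w = B w) -> sqn A = sqn B.
Proof.
move=> mA mB AB; apply: ae_eq_integral => //.
- exact: measurable_EFin_normc_sqr.
- exact: measurable_EFin_normc_sqr.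
- by apply: filterS AB => w -> _.
Qed.

Lemma sqnZ z A : complex_RV A ->
  sqn (fun w => z * A w)%R = (normc z ^+ 2)%:E * sqn A.
Proof.
move=> mA; rewrite /sqn; under eq_integral do rewrite normcM exprMn EFinM.
rewrite ge0_integralZl_EFin//.
- by move=> w _; rewrite lee_fin normc_sqr_ge0.
- exact: measurable_EFin_normc_sqr.
- exact: sqr_ge0.
Qed.

Lemma sqnZ1 z A : complex_RV A -> normc z = 1%R ->
  sqn (fun w => z * A w)%R = sqn A.
Proof. by move=> mA z1; rewrite sqnZ// z1 expr1n mul1e. Qed.

Lemma sqnN A : complex_RV A -> sqn (fun w => - A w)%R = sqn A.
Proof.
move=> mA; under [in LHS]eq_fun do rewrite -mulN1r.
by rewrite sqnZ1// normcN normc1.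
Qed.

Lemma sqn_subC A B : complex_RV A -> complex_RV B ->
  sqn (fun w => A w - B w)%R = sqn (fun w => B w - A w)%R.
Proof.
move=> mA mB; rewrite -sqnN; last exact: complex_RVB.
by under [in LHS]eq_fun do rewrite opprB.
Qed.

Lemma sqn0 : sqn (fun _ => 0%R) = 0.
Proof. by rewrite /sqn; apply: integral0_eq => w _; rewrite normc0 expr0n. Qed.

Lemma sqnD A B : complex_RV A -> complex_RV B ->
  sqn (fun w => A w + B w)%R <= 2%:E * sqn A + 2%:E * sqn B.
Proof.
move=> mA mB.
have mA2 := measurable_EFin_normc_sqr mA.
have mB2 := measurable_EFin_normc_sqr mB.
rewrite -!ge0_integralZl_EFin//; try by move=> w _; rewrite lee_fin normc_sqr_ge0.
rewrite -ge0_integralD//; try by move=> w _; rewrite mule_ge0// lee_fin normc_sqr_ge0.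
- apply: ge0_le_integral => //.
  + by move=> w _; rewrite lee_fin normc_sqr_ge0.
  + by apply: measurable_EFin_normc_sqr; exact: complex_RVD.
  + apply: emeasurable_funD; exact: measurable_funeM.
  + by move=> w _; rewrite lee_fin normc_sqrD_le.
- exact: measurable_funeM.
- exact: measurable_funeM.
Qed.

(** Convexity of the square: averaging does not increase the largest mean
    square.  It replaces Minkowski's inequality everywhere below. *)
Lemma sqn_mean (n : nat) (Z : nat -> T -> R[i]) (K : \bar R) : (0 < n)%N ->
  (forall y, (y < n)%N -> complex_RV (Z y)) ->
  (forall y, (y < n)%N -> sqn (Z y) <= K) ->
  sqn (fun w => n%:R^-1 * \sum_(0 <= y < n) Z y w)%R <= K.
Proof.
move=> n0 mZ ZK.
have mS : complex_RV (fun w => \sum_(0 <= y < n) Z y w)%R.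
  under eq_fun do rewrite big_mkord.
  by apply: complex_RV_sum => i _; exact: mZ.
rewrite sqnZ//.
have nR : (0 < n%:R :> R)%R by rewrite ltr0n.
have K0 : 0 <= K by apply: le_trans (ZK 0%N n0); exact: sqn_ge0.
have -> : (normc (n%:R^-1 : R[i]) ^+ 2 = n%:R ^- 2)%R.
  rewrite normcV -[n%:R]/(1 *+ n)%R normcMn normc1 exprVn//.
have le1 : sqn (fun w => \sum_(0 <= y < n) Z y w)%R <=
    n%:R%:E * \sum_(0 <= y < n) sqn (Z y).
  rewrite big_mkord -ge0_integral_sum//.
  - rewrite -ge0_integralZl_EFin//.
    + apply: ge0_le_integral => //.
      * by move=> w _; rewrite lee_fin normc_sqr_ge0.
      * exact: measurable_EFin_normc_sqr.
      * apply: measurable_funeM; apply: emeasurable_sum => i.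
        exact/measurable_EFin_normc_sqr/mZ.
      * move=> w _; rewrite sumEFin -EFinM lee_fin.
        by rewrite -(big_mkord xpredT (fun i => normc (Z i w) ^+ 2)%R) normc_sqr_sum_le.
    + by move=> w _; apply: sume_ge0 => i _; rewrite lee_fin normc_sqr_ge0.
    + apply: emeasurable_sum => i; exact/measurable_EFin_normc_sqr/mZ.
  - by move=> i; exact/measurable_EFin_normc_sqr/mZ.
  - by move=> i w _; rewrite lee_fin normc_sqr_ge0.
have le2 : \sum_(0 <= y < n) sqn (Z y) <= n%:R%:E * K.
  rewrite big_mkord (@le_trans _ _ (\sum_(i < n) K))//.
    by apply: lee_sum => i _; exact: ZK.
  by rewrite sumr_const card_ord mule_natl.
apply: le_trans (lee_wpmul2l _ le1) _; first by rewrite lee_fin invr_ge0 sqr_ge0.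
rewrite muleA -EFinM.
apply: le_trans (lee_wpmul2l _ le2) _.
  by rewrite lee_fin mulr_ge0// invr_ge0 sqr_ge0.
rewrite muleA -EFinM (_ : (_ * _)%R = 1%R) ?mul1e//.
by rewrite -mulrA -expr2 mulVf// expf_neq0// gt_eqF.
Qed.

End square_norm.

(** * Convergence in mean square *)

Section mean_square_convergence.
Context d (T : measurableType d) (R : realType) (P : probability T R).
Implicit Types (Y Z : T -> R[i]) (S : nat -> T -> R[i]).
Local Open Scope ereal_scope.

Lemma cvge0P (u : nat -> \bar R) : (forall n, 0 <= u n) ->
  u @ \oo --> 0 <->
  forall e : R, (0 < e)%R -> exists N, forall n, (N <= n)%N -> u n <= e%:E.
Proof.
move=> u0; split=> [/fine_cvgP[ufin u_0] e e0|uP].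
  have /cvgrPdist_le /(_ e e0)[N _ HN] := u_0.
  have [M _ HM] := ufin.
  exists (maxn N M) => n; rewrite geq_max => /andP[Nn Mn].
  have un := HM n Mn; rewrite -(fineK un) lee_fin.
  by have := HN n Nn; rewrite /= sub0r normrN; apply: le_trans; exact: ler_norm.
have ufin : \forall n \near \oo, u n \is a fin_num.
  have [N HN] := uP 1%R ltr01.
  exists N => // n Nn; rewrite ge0_fin_numE//.
  by apply: le_lt_trans (HN n Nn) _; exact: ltry.
apply/fine_cvgP; split => //; apply/cvgrPdist_le => e e0.
have [N HN] := uP e e0.
near=> n; have un : u n \is a fin_num by near: n.
rewrite /= sub0r normrN ger0_norm ?fine_ge0//.
rewrite -lee_fin fineK//; apply: HN; near: n; exact: nbhs_infty_ge.
Unshelve. all: by end_near.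
Qed.

Lemma cvg_L2P S Y : cvg_L2 P S Y <->
  forall e : R, (0 < e)%R -> exists N, forall n, (N <= n)%N ->
  sqn P (fun w => S n w - Y w)%R <= e%:E.
Proof.
rewrite /cvg_L2; under eq_fun do rewrite sqnE.
by apply: cvge0P => n; exact: sqn_ge0.
Qed.

Lemma cvg_L2_le S Y (u : nat -> R) N : (u @ \oo --> (0 : R)%R)%classic ->
  (forall n, (N <= n)%N -> sqn P (fun w => S n w - Y w)%R <= (u n)%:E) ->
  cvg_L2 P S Y.
Proof.
move=> /cvgrPdist_le u0 SY; apply/cvg_L2P => e e0.
have [M _ HM] := u0 e e0.
exists (maxn N M) => n; rewrite geq_max => /andP[Nn Mn].
apply: le_trans (SY n Nn) _; rewrite lee_fin.
by have := HM n Mn; rewrite /= sub0r normrN; apply: le_trans; exact: ler_norm.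
Qed.

Lemma cvg_L2_eq S S' Y N : (forall n, (N <= n)%N -> S n = S' n) ->
  cvg_L2 P S Y -> cvg_L2 P S' Y.
Proof.
move=> SS' /cvg_L2P SY; apply/cvg_L2P => e /SY[M HM].
exists (maxn N M) => n; rewrite geq_max => /andP[Nn Mn].
by rewrite -SS'// HM.
Qed.

Lemma cvg_L2_shift S Y k : cvg_L2 P S Y -> cvg_L2 P (fun n => S (n + k)%N) Y.
Proof.
move=> /cvg_L2P SY; apply/cvg_L2P => e /SY[M HM].
by exists M => n Mn; apply: HM; rewrite (leq_trans Mn)// leq_addr.
Qed.

Lemma cvg_L2_cst Y : cvg_L2 P (fun _ => Y) Y.
Proof.
apply/cvg_L2P => e e0; exists 0%N => n _.
under [X in sqn P X]eq_fun do rewrite subrr.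
by rewrite sqn0 lee_fin ltW.
Qed.

Lemma cvg_L2D S S' Y Y' :
  (forall n, complex_RV (S n)) -> (forall n, complex_RV (S' n)) ->
  complex_RV Y -> complex_RV Y' ->
  cvg_L2 P S Y -> cvg_L2 P S' Y' ->
  cvg_L2 P (fun n w => S n w + S' n w)%R (fun w => Y w + Y' w)%R.
Proof.
move=> mS mS' mY mY' /cvg_L2P SY /cvg_L2P SY'; apply/cvg_L2P => e e0.
have e4 : (0 < e / 4)%R by rewrite divr_gt0.
have [N HN] := SY _ e4; have [M HM] := SY' _ e4.
exists (maxn N M) => n; rewrite geq_max => /andP[Nn Mn].
under [X in sqn P X]eq_fun do rewrite opprD addrACA.
apply: le_trans (sqnD P _ _) _; [exact: complex_RVB..|].
have -> : e%:E = 2%:E * (e / 4)%:E + 2%:E * (e / 4)%:E.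
  by rewrite -EFinM -EFinD; congr (_%:E); field.
by apply: leeD; apply: lee_wpmul2l => //; [exact: HN|exact: HM].
Qed.

Lemma cvg_L2Z z S Y :
  (forall n, complex_RV (S n)) -> complex_RV Y ->
  cvg_L2 P S Y -> cvg_L2 P (fun n w => z * S n w)%R (fun w => z * Y w)%R.
Proof.
move=> mS mY /cvg_L2P SY; apply/cvg_L2P => e e0.
have z1 : (0 < 1 + normc z ^+ 2)%R by rewrite ltr_pwDl// sqr_ge0.
have [N HN] := SY (e / (1 + normc z ^+ 2))%R (divr_gt0 e0 z1).
exists N => n Nn.
under [X in sqn P X]eq_fun do rewrite -mulrBr.
rewrite sqnZ; last exact: complex_RVB.
apply: le_trans (lee_wpmul2l _ (HN n Nn)) _; first by rewrite lee_fin sqr_ge0.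
rewrite -EFinM lee_fin mulrC -mulrA ger_pMr// mulrC ler_pdivrMr// mul1r.
by rewrite lerDr.
Qed.

Lemma cvg_L2_sum (I : Type) (s : seq I) (Q : pred I) (S : I -> nat -> T -> R[i])
    (Y : I -> T -> R[i]) :
  (forall i n, Q i -> complex_RV (S i n)) -> (forall i, Q i -> complex_RV (Y i)) ->
  (forall i, Q i -> cvg_L2 P (S i) (Y i)) ->
  cvg_L2 P (fun n w => \sum_(i <- s | Q i) S i n w)%R
           (fun w => \sum_(i <- s | Q i) Y i w)%R.
Proof.
move=> mS mY SY; elim: s => [|i s IH].
  rewrite (_ : (fun w => _) = (fun _ : T => 0%R)); last first.
    by apply/funext => w; rewrite big_nil.
  rewrite (_ : (fun n w => _) = (fun _ (_ : T) => 0%R)); last first.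
    by apply/funext => n; apply/funext => w; rewrite big_nil.
  exact: cvg_L2_cst.
rewrite (_ : (fun w => _) = (fun w => (if Q i then Y i w else 0) +
    \sum_(j <- s | Q j) Y j w)%R); last first.
  by apply/funext => w; rewrite big_cons; case: (Q i) => //; rewrite add0r.
rewrite (_ : (fun n w => _) = (fun n w => (if Q i then S i n w else 0) +
    \sum_(j <- s | Q j) S j n w)%R); last first.
  by apply/funext => n; apply/funext => w; rewrite big_cons; case: (Q i) => //; rewrite add0r.
apply: cvg_L2D => //.
- by move=> n; case: (boolP (Q i)) => Qi; [exact: mS|exact: complex_RV_cst].
- by move=> n; apply: complex_RV_sum => j; exact: mS.
- by case: (boolP (Q i)) => Qi; [exact: mY|exact: complex_RV_cst].
- exact: complex_RV_sum.
- by case: (boolP (Q i)) => Qi; [exact: SY|exact: cvg_L2_cst].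
Qed.

(** A bound that holds along the approximants passes to the limit, up to the
    factor 2 of [sqnD], which is harmless since only convergence to 0 is at
    stake. *)
Lemma sqn_cvg_le S Y Z (K : R) N :
  (forall n, complex_RV (S n)) -> complex_RV Y -> complex_RV Z ->
  cvg_L2 P S Y ->
  (forall n, (N <= n)%N -> sqn P (fun w => S n w - Z w)%R <= K%:E) ->
  sqn P (fun w => Y w - Z w)%R <= (2 * K)%:E.
Proof.
move=> mS mY mZ /cvg_L2P SY SZ; apply/lee_addgt0Pr => e e0.
have e2 : (0 < e / 2)%R by rewrite divr_gt0.
have [M HM] := SY _ e2; pose n := maxn N M.
have -> : (fun w => Y w - Z w)%R =
    (fun w => -1 * (S n w - Y w) + (S n w - Z w))%R.
  by apply/funext => w; rewrite mulN1r opprB [RHS]addrA subrK.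
apply: le_trans (sqnD P _ _) _; [exact/complex_RVZ/complex_RVB|exact: complex_RVB|].
rewrite sqnZ1; [|exact: complex_RVB|by rewrite normcN normc1].
have -> : (2 * K)%:E + e%:E = 2%:E * (e / 2)%:E + 2%:E * K%:E.
  by rewrite -!EFinM -!EFinD; congr (_%:E); field.
apply: leeD; apply: lee_wpmul2l => //; [apply: HM|apply: SZ].
  exact: leq_maxr.
exact: leq_maxl.
Qed.

(** A series of nonnegative variables with finite total expectation is almost
    surely finite; this is the Borel-Cantelli step behind every almost sure
    convergence below. *)
Lemma ae_summable (f : nat -> T -> R) :
  (forall j, measurable_fun setT (f j)) -> (forall j w, (0 <= f j w)%R) ->
  \sum_(j <oo) \int[P]_w (f j w)%:E < +oo ->
  \forall w \ae P, cvgn (series (f ^~ w)).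
Proof.
move=> mf f0 foo.
pose g w := \sum_(j <oo) (f j w)%:E.
have mg : measurable_fun setT g.
  apply: ge0_emeasurable_sum => // [j w _ _|j _]; first by rewrite lee_fin.
  exact/measurable_EFinP.
have g0 w : 0 <= g w by apply: nneseries_ge0 => j _ _; rewrite lee_fin.
have gint : P.-integrable setT g.
  apply/integrableP; split => //.
  under eq_integral do rewrite gee0_abs//.
  rewrite integral_nneseries//.
  - by move=> n; exact/measurable_EFinP.
  - by move=> n w _; rewrite lee_fin.
have := integrable_ae measurableT gint.
apply: filterS => w /(_ I) gfin; apply: nondecreasing_is_cvgn.
  by apply: nondecreasing_series => n _ _.
exists (fine (g w)) => _ [n _ <-].
rewrite -lee_fin fineK// /series/= -sumEFin.
by apply: nneseries_lim_ge => j _ _; rewrite lee_fin.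
Qed.

End mean_square_convergence.

(** * Limits as measurable functionals *)

Section limits_as_functionals.
Context d (T : measurableType d) (R : realType) (P : probability T R).
Implicit Types (Y Z : T -> R[i]) (S : nat -> T -> R[i]).

(** A limit that is defined, and measurable, for every sequence: the limit
    superior, forced to be finite. *)
Definition rlim (u : nat -> R) : R := fine (limn_esup (fun n => (u n)%:E)).

Definition clim (z : nat -> R[i]) : R[i] :=
  Complex (rlim (fun n => complex.Re (z n))) (rlim (fun n => complex.Im (z n))).

Lemma rlim_cvg (u : nat -> R) (l : R) : u @ \oo --> l -> rlim u = l.
Proof.
move=> ul; rewrite /rlim (_ : limn_esup _ = l%:E)//.
have /cvg_limn_einf_sup[_ ->]// : (u n)%:E @[n --> \oo] --> l%:E.
by apply/cvg_EFin => //; near=> n.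
Unshelve. all: by end_near.
Qed.

Lemma measurable_rlim d' (U : measurableType d') (u : nat -> U -> R) :
  (forall n, measurable_fun setT (u n)) ->
  measurable_fun setT (fun w => rlim (u^~ w)).
Proof.
move=> mu; apply: (measurableT_comp (@fine_measurable R setT measurableT)).
by apply: measurable_fun_limn_esup => n; exact/measurable_EFinP.
Qed.

Lemma complex_RV_clim d' (U : measurableType d') (u : nat -> U -> R[i]) :
  (forall n, complex_RV (u n)) -> complex_RV (fun w => clim (u^~ w)).
Proof.
move=> mu; apply/complex_RVP; split; apply: measurable_rlim => n.
- by have /complex_RVP[] := mu n.
- by have /complex_RVP[] := mu n.
Qed.

Lemma normc_sqr_cvg0 (z : nat -> R[i]) (l : R[i]) :
  (normc (z n - l) ^+ 2 @[n --> \oo] --> (0 : R)) -> clim z = l.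
Proof.
move=> zl.
have part (f : R[i] -> R) : (forall x y, f (x - y) = f x - f y) ->
    (forall x, f x ^+ 2 <= normc x ^+ 2) -> f (z n) @[n --> \oo] --> f l.
  move=> fB fle; apply/cvgrPdist_le => e e0.
  have e2 : 0 < e ^+ 2 by rewrite exprn_gt0.
  move/cvgrPdist_le: zl => /(_ _ e2); apply: filterS => n.
  rewrite sub0r normrN ger0_norm ?sqr_ge0// => ze.
  rewrite distrC -fB -ler_sqr ?nnegrE ?normr_ge0 ?(ltW e0)//.
  by rewrite real_normK ?num_real// (le_trans (fle _)).
case: l zl part => a b zl part; congr Complex; apply: rlim_cvg.
- apply: (part (@complex.Re R)) => [[? ?] [? ?]//|x].
  by rewrite normc_sqr lerDl sqr_ge0.
- apply: (part (@complex.Im R)) => [[? ?] [? ?]//|x].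
  by rewrite normc_sqr lerDr sqr_ge0.
Qed.

(** Summable weights 2^-(j+1): a sequence whose mean squares are bounded by
    them converges almost surely. *)
Definition fast_weight (j : nat) : R := 1 / (2 ^ j.+1)%:R.

Lemma fast_weight_gt0 j : 0 < fast_weight j.
Proof. by rewrite divr_gt0// ltr0n expn_gt0. Qed.

Lemma fast_weight_series (u : nat -> \bar R) : (forall j, 0 <= u j)%E ->
  (forall j, u j <= (fast_weight j)%:E)%E -> (\sum_(j <oo) u j < +oo)%E.
Proof.
move=> u0 uw; apply: (@le_lt_trans _ _ 1%:E); last exact: ltry.
apply: le_trans (@epsilon_trick0 R 1 xpredT ler01).
by apply: lee_nneseries => j _ //; exact: u0.
Qed.

(** The squared errors have summable expectations, hence tend to 0 almost
    surely. *)
Lemma ae_clim S Y (phi : nat -> nat) :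
  (forall n, complex_RV (S n)) -> complex_RV Y ->
  (forall j, sqn P (fun w => S (phi j) w - Y w)%R <= (fast_weight j)%:E)%E ->
  \forall w \ae P, clim (fun j => S (phi j) w) = Y w.
Proof.
move=> mS mY SY.
have mD j : complex_RV (fun w => S (phi j) w - Y w) by exact: complex_RVB.
have sum_fin : (\sum_(j <oo) sqn P (fun w => S (phi j) w - Y w)%R < +oo)%E.
  by apply: fast_weight_series => // j; exact: sqn_ge0.
have := ae_summable (fun j => measurable_normc_sqr (mD j))
  (fun j w => normc_sqr_ge0 _) sum_fin.
apply: filterS => w /cvg_series_cvg_0; exact: normc_sqr_cvg0.
Qed.

(** Equality of laws passes to mean square limits.  The subsequence [phi] is
    chosen index by index, fast for both families, so that [Y'] and [Z'] are
    almost surely one and the same functional of [Y] and of [Z].  The hypothesis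
    concerns the joint law over the orders of approximation as well. *)
Lemma eq_dist_cvg_L2 (I : countType) (Y Z : nat -> I -> T -> R[i])
    (Y' Z' : I -> T -> R[i]) :
  (forall n i, complex_RV (Y n i)) -> (forall n i, complex_RV (Z n i)) ->
  (forall i, complex_RV (Y' i)) -> (forall i, complex_RV (Z' i)) ->
  (forall i, cvg_L2 P (fun n => Y n i) (Y' i)) ->
  (forall i, cvg_L2 P (fun n => Z n i) (Z' i)) ->
  complex_eq_dist P (fun (ni : nat * I) => Y ni.1 ni.2)
                    (fun (ni : nat * I) => Z ni.1 ni.2) ->
  complex_eq_dist P Y' Z'.
Proof.
move=> mY mZ mY' mZ' YY' ZZ' YZ.
(* One rank for both families, so that a single functional [F] serves both. *)
have /choice[phi phiP] : forall ij : I * nat, exists n : nat,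
    (sqn P (fun w => Y n ij.1 w - Y' ij.1 w)%R <= (fast_weight ij.2)%:E)%E /\
    (sqn P (fun w => Z n ij.1 w - Z' ij.1 w)%R <= (fast_weight ij.2)%:E)%E.
  move=> [i j] /=.
  have /cvg_L2P/(_ _ (fast_weight_gt0 j))[N HN] := YY' i.
  have /cvg_L2P/(_ _ (fast_weight_gt0 j))[M HM] := ZZ' i.
  by exists (maxn N M); split; [apply: HN|apply: HM]; rewrite ?leq_maxl ?leq_maxr.
pose F (i : I) (f : nat * I -> R[i]) := clim (fun j => f (phi (i, j), i)).
have mF i : complex_RV (fun f : complex_space R (nat * I) =>
    F i (fun k => entry k f)).
  by apply: complex_RV_clim => j; exact: complex_RV_entry.
apply: (complex_eq_dist_ae _ _ mY' mZ' _ _ (complex_eq_dist_map mF YZ)) => i /=.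
- by apply: complex_RV_clim => j; exact: mY.
- by apply: complex_RV_clim => j; exact: mZ.
- apply: (ae_clim (S := fun n => Y n i) (phi := fun j => phi (i, j))) => // j.
  exact: (phiP (i, j)).1.
- apply: (ae_clim (S := fun n => Z n i) (phi := fun j => phi (i, j))) => // j.
  exact: (phiP (i, j)).2.
Qed.

End limits_as_functionals.

(** * Laws, integrals and completeness *)

Section laws_and_integrals.
Context d (T : measurableType d) (R : realType) (P : probability T R).

(** Both integrals are integrals over the space of families against the image
    measure; splitting into positive and negative parts removes any integrability
    condition. *)
Lemma integral_eq_dist (I : Type) (Y Z : I -> T -> R[i]) (g : (I -> R[i]) -> R) :
  (forall i, complex_RV (Y i)) -> (forall i, complex_RV (Z i)) ->
  measurable_fun setT (fun f : complex_space R I => g (fun i => entry i f)) ->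
  complex_eq_dist P Y Z ->
  (\int[P]_w (g (Y^~ w))%:E = \int[P]_w (g (Z^~ w))%:E)%E.
Proof.
move=> mY mZ mg YZ.
pose law (U : I -> T -> R[i]) : T -> complex_space R I :=
  fun w i => pair_of_complex (U i w).
have mlaw (U : I -> T -> R[i]) : (forall i, complex_RV (U i)) ->
    measurable_fun setT (law U).
  by move=> mU; exact: measurable_family.
have lawE (U : I -> T -> R[i]) w : U^~ w = (fun i => entry i (law U w)).
  by apply/funext => i; rewrite /entry pair_of_complexK.
have ge0_int (h : complex_space R I -> \bar R) : measurable_fun setT h ->
    (forall f, 0 <= h f)%E ->
    (\int[P]_w h (law Y w) = \int[P]_w h (law Z w))%E.
  move=> mh h0.
  pose F U mU : {mfun T >-> complex_space R I} :=
    HB.pack (law U) (isMeasurableFun.Build _ _ _ _ _ (mlaw U mU)).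
  rewrite -[LHS](@ge0_integral_pushforward _ _ _ _ _ _ (mlaw Y mY) P setT h)//.
  rewrite -[RHS](@ge0_integral_pushforward _ _ _ _ _ _ (mlaw Z mZ) P setT h)//.
  apply: (@eq_measure_integral _ _ _ setT (pushforward P (F Z mZ)) (pushforward P (F Y mY))).
  by move=> C mC _; exact: YZ.
pose h (f : complex_space R I) := (g (fun i => entry i f))%:E.
have mh : measurable_fun setT h by exact/measurable_EFinP.
have intE (U : I -> T -> R[i]) : (\int[P]_w (g (U^~ w))%:E =
   \int[P]_w (h^\+ (law U w)) - \int[P]_w (h^\- (law U w)))%E.
  rewrite integralE; congr (_ - _)%E; apply: eq_integral => w _.
  - by rewrite !funeposE /h -lawE.
  - by rewrite !funenegE /h -lawE.
rewrite !intE !(ge0_int h^\+%E)// ?(ge0_int h^\-%E)//.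
- exact: measurable_funeneg.
- exact: measurable_funepos.
Qed.

Lemma sqn_eq_dist (I : Type) (Y Z : I -> T -> R[i]) (i : I) :
  (forall i, complex_RV (Y i)) -> (forall i, complex_RV (Z i)) ->
  complex_eq_dist P Y Z -> sqn P (Y i) = sqn P (Z i).
Proof.
move=> mY mZ; apply: (integral_eq_dist (g := fun f => normc (f i) ^+ 2)) => //.
exact: (measurable_normc_sqr (complex_RV_entry i)).
Qed.

(** The mixed second moments, which express orthogonality, are determined by
    the joint law. *)
Lemma complex_expectation_eq_dist (I : Type) (Y Z : I -> T -> R[i]) (i j : I) :
  (forall i, complex_RV (Y i)) -> (forall i, complex_RV (Z i)) ->
  complex_eq_dist P Y Z ->
  complex_expectation P (fun w => Y i w * conjc (Y j w)) =
  complex_expectation P (fun w => Z i w * conjc (Z j w)).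
Proof.
move=> mY mZ YZ; rewrite /complex_expectation unlock.
have [mre mim] : measurable_fun setT (fun f : complex_space R I =>
      complex.Re (entry i f * conjc (entry j f))) /\
    measurable_fun setT (fun f : complex_space R I =>
      complex.Im (entry i f * conjc (entry j f))).
  have := complex_RVM (@complex_RV_entry R I i)
    (complex_RV_conj (@complex_RV_entry R I j)).
  by move/complex_RVP.
congr Complex; congr fine.
- by apply: (integral_eq_dist (g := fun f => complex.Re (f i * conjc (f j)))).
- by apply: (integral_eq_dist (g := fun f => complex.Im (f i * conjc (f j)))).
Qed.

End laws_and_integrals.

Section second_moments.
Context d (T : measurableType d) (R : realType) (P : probability T R).

Lemma complex_expectationZ (c : R[i]) (Z : T -> R[i]) :
  P.-integrable setT (fun w => (complex.Re (Z w))%:E) ->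
  P.-integrable setT (fun w => (complex.Im (Z w))%:E) ->
  complex_expectation P (fun w => c * Z w) = c * complex_expectation P Z.
Proof.
move=> reZ imZ; rewrite /complex_expectation unlock.
have lin (a b : R) : fine (\int[P]_w (a * complex.Re (Z w) +
      b * complex.Im (Z w))%:E)%E =
    a * fine (\int[P]_w (complex.Re (Z w))%:E)%E +
    b * fine (\int[P]_w (complex.Im (Z w))%:E)%E.
  have iZ (e : R) (f : T -> R) : P.-integrable setT (EFin \o f) ->
      P.-integrable setT (EFin \o (fun w => e * f w)).
    by move=> fi; have := integrableZl measurableT e fi.
  rewrite -[LHS]/(Rintegral P setT _) RintegralD ?RintegralZl//; exact: iZ.
have reE : fine (\int[P]_w (complex.Re (c * Z w))%:E)%E =
    complex.Re c * fine (\int[P]_w (complex.Re (Z w))%:E)%E +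
    (- complex.Im c) * fine (\int[P]_w (complex.Im (Z w))%:E)%E.
  by rewrite -lin; congr fine; apply: eq_integral => w _; rewrite ReM mulNr.
have imE : fine (\int[P]_w (complex.Im (c * Z w))%:E)%E =
    complex.Im c * fine (\int[P]_w (complex.Re (Z w))%:E)%E +
    complex.Re c * fine (\int[P]_w (complex.Im (Z w))%:E)%E.
  by rewrite -lin; congr fine; apply: eq_integral => w _; rewrite ImM addrC.
rewrite reE imE; case: c {reE imE} => a b /=.
by apply/eqP; rewrite eq_complex/= mulNr [X in _ && (X == _)]addrC !eqxx.
Qed.

(** From |a b| <= |a|^2 + |b|^2; [f] is the real or the imaginary part. *)
Lemma integrable_product (Y Z : T -> R[i]) (f : R[i] -> R) :
  complex_RV Y -> complex_RV Z -> (sqn P Y < +oo)%E -> (sqn P Z < +oo)%E ->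
  measurable_fun setT (fun w => f (Y w * conjc (Z w))) ->
  (forall z, `|f z| <= normc z) ->
  P.-integrable setT (fun w => (f (Y w * conjc (Z w)))%:E).
Proof.
move=> mY mZ Yoo Zoo mf fle; apply/integrableP; split.
  exact/measurable_EFinP.
have nconj z : normc (conjc z) = normc z :> R by case: z => a b /=; rewrite sqrrN.
apply: (@le_lt_trans _ _ (sqn P Y + sqn P Z)%E); last first.
  by rewrite lte_add_pinfty.
rewrite /sqn -ge0_integralD//; first last.
- exact: measurable_EFin_normc_sqr.
- by move=> w _; rewrite lee_fin sqr_ge0.
- exact: measurable_EFin_normc_sqr.
- by move=> w _; rewrite lee_fin sqr_ge0.
apply: ge0_le_integral => //.
- by apply/measurable_EFinP; exact: measurableT_comp.
- by apply: emeasurable_funD; exact: measurable_EFin_normc_sqr.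
move=> w _; rewrite -EFinD lee_fin (le_trans (fle _))// normcM nconj.
have ge0 z : 0 <= normc z :> R by case: z => a b /=; exact: sqrtr_ge0.
move: (normc (Y w)) (normc (Z w)) (ge0 (Y w)) (ge0 (Z w)) => a b a0 b0.
have := sqr_ge0 (a - b); nra.
Qed.

Lemma normc_Re (z : R[i]) : `|complex.Re z| <= normc z.
Proof.
case: z => a b /=; rewrite -(sqrtr_sqr a) ler_wsqrtr// lerDl sqr_ge0//.
Qed.

Lemma normc_Im (z : R[i]) : `|complex.Im z| <= normc z.
Proof.
case: z => a b /=; rewrite -(sqrtr_sqr b) ler_wsqrtr// lerDr sqr_ge0//.
Qed.

End second_moments.

Section completeness.
Context d (T : measurableType d) (R : realType) (P : probability T R).
Local Open Scope ereal_scope.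

Lemma limn_einf_le (u : nat -> \bar R) (K : \bar R) N :
  (forall n, (N <= n)%N -> u n <= K) -> limn_einf u <= K.
Proof.
move=> uK; rewrite limn_einf_lim; apply: lime_le; first exact: is_cvg_einfs.
exists N => // n /= Nn; apply: le_trans (uK n Nn).
by apply: ereal_inf_lbound; exists n => /=.
Qed.

(** Completeness of L^2.  Along a subsequence with increments of mean square at
    most 4^-(j+1) the increments are almost surely absolutely summable, which
    gives a pointwise limit; Fatou's lemma shows that it is also the limit in mean
    square of the whole sequence. *)
Lemma cvg_L2_complete (S : nat -> T -> R[i]) :
  (forall n, complex_RV (S n)) ->
  (forall e : R, (0 < e)%R -> exists N, forall m n, (N <= m)%N -> (N <= n)%N ->
     sqn P (fun w => S m w - S n w)%R <= e%:E) ->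
  exists Y, complex_RV Y /\ cvg_L2 P S Y.
Proof.
move=> mS cS.
pose r := @fast_weight R.
have r0 j : (0 < r j)%R by exact: fast_weight_gt0.
have /choice[N HN] : forall j, exists N, forall m n, (N <= m)%N -> (N <= n)%N ->
     sqn P (fun w => S m w - S n w)%R <= (r j ^+ 2)%:E.
  by move=> j; apply: cS; rewrite exprn_gt0.
(* The successor makes [phi] unbounded even when the ranks [N] are not. *)
pose phi j := (\sum_(i < j.+1) (N i).+1)%N.
have phiN j : (N j <= phi j)%N.
  by rewrite /phi big_ord_recr/= (leq_trans _ (leq_addl _ _)).
have phiS j : (phi j <= phi j.+1)%N by rewrite /phi [in leqRHS]big_ord_recr leq_addr.
have phij j : (j <= phi j)%N.
  elim: j => // j IH; rewrite /phi big_ord_recr/=.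
  by apply: (leq_ltn_trans IH); rewrite addnS ltnS leq_addr.
pose Z j := S (phi j).
pose D j w : R[i] := (Z j.+1 w - Z j w)%R.
have mD j : complex_RV (D j) by exact: (complex_RVB (mS _) (mS _)).
have D_sum : \forall w \ae P,
    cvgn (series (fun j => (r j)^-1 * normc (D j w) ^+ 2)%R).
  apply: ae_summable.
  - by move=> j; apply: measurable_funM => //; exact: measurable_normc_sqr.
  - by move=> j w; rewrite mulr_ge0 ?sqr_ge0// invr_ge0 ltW.
  - apply: fast_weight_series => j.
      apply: integral_ge0 => w _.
      by rewrite lee_fin mulr_ge0 ?sqr_ge0// invr_ge0 ltW.
    under eq_integral do rewrite EFinM.
    rewrite ge0_integralZl_EFin//.
    + apply: (@le_trans _ _ ((r j)^-1%:E * (r j ^+ 2)%:E)).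
        apply: lee_wpmul2l; first by rewrite lee_fin invr_ge0 ltW.
        by apply: HN => //; exact: leq_trans (phiS j).
      by rewrite -EFinM expr2 mulrA mulVf ?mul1r// gt_eqF.
    + by move=> w _; rewrite lee_fin sqr_ge0.
    + exact: measurable_EFin_normc_sqr.
    + by rewrite invr_ge0 ltW.
pose Y w := clim (Z^~ w).
have mY : complex_RV Y by apply: complex_RV_clim => j; exact: mS.
(* The real and imaginary parts converge because r_j + |D_j|^2 / r_j, which is
   almost surely summable, bounds |D_j|. *)
have Z_cvg : \forall w \ae P, forall n,
    (normc (S n w - Z j w) ^+ 2)%:E @[j --> \oo] --> (normc (S n w - Y w) ^+ 2)%:E.
  apply: filterS D_sum => w Dw n.
  have part (f : R[i] -> R) : (forall x y, f (x - y) = f x - f y)%R ->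
      (forall x, f x ^+ 2 <= normc x ^+ 2)%R ->
      (f (Z j w) @[j --> \oo] --> rlim (fun j => f (Z j w)))%classic.
    move=> fB fle.
    have fD_sum : cvgn (series (fun j => (f (Z j.+1 w) - f (Z j w))%R)).
      apply: normed_cvg.
      apply: (@series_le_cvg _ _ (fun j => r j + (r j)^-1 * normc (D j w) ^+ 2)%R).
      - by move=> j; exact: normr_ge0.
      - by move=> j; rewrite addr_ge0 ?(ltW (r0 j))// mulr_ge0 ?sqr_ge0// invr_ge0 ltW.
      - move=> j /=; rewrite -fB.
        have := fle (Z j.+1 w - Z j w)%R; rewrite -/(D j w).
        rewrite -[in X in X -> _](real_normK (num_real (f (D j w)))).
        by move=> tq; apply: le_add_sqr_div => //; exact: normr_ge0.
      - have -> : (fun j => r j + (r j)^-1 * normc (D j w) ^+ 2)%R =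
          (r \+ (fun j => (r j)^-1 * normc (D j w) ^+ 2))%R by [].
        rewrite seriesD; apply: is_cvgD => //.
        have -> : r = geometric 2^-1%R 2^-1%R.
          apply/funext => j; rewrite /r /fast_weight /geometric/=.
          by rewrite div1r natrX -exprS exprVn.
        apply: is_cvg_geometric_series.
        by rewrite ger0_norm ?invr_ge0// invf_lt1// ltr1n.
    have c : cvgn (fun j => f (Z j w)).
      have -> : (fun j => f (Z j w)) = (fun j => f (Z 0%N w) +
           series (fun j => (f (Z j.+1 w) - f (Z j w))%R) j)%R.
        by apply/funext => j; rewrite /series/= telescope_sumr// addrC subrK.
      by apply: is_cvgD => //; exact: is_cvg_cst.
    by rewrite (rlim_cvg c).
  have reZ : (complex.Re (Z j w) @[j --> \oo] --> complex.Re (Y w))%classic.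
    apply: (part (@complex.Re R)) => [[? ?] [? ?]//|x].
    by rewrite normc_sqr lerDl sqr_ge0.
  have imZ : (complex.Im (Z j w) @[j --> \oo] --> complex.Im (Y w))%classic.
    apply: (part (@complex.Im R)) => [[? ?] [? ?]//|x].
    by rewrite normc_sqr lerDr sqr_ge0.
  apply/cvg_EFin; first by near=> j.
  have sqrE (x : R[i]) : (normc (S n w - x) ^+ 2 =
    (complex.Re (S n w) - complex.Re x) ^+ 2 +
    (complex.Im (S n w) - complex.Im x) ^+ 2)%R.
    by rewrite normc_sqr; case: (S n w) x => ? ? [].
  rewrite /comp/= sqrE; under eq_fun do rewrite sqrE.
  apply: cvgD; rewrite expr2; under eq_fun do rewrite expr2.
    by apply: cvgM; apply: cvgB => //; exact: cvg_cst.
  by apply: cvgM; apply: cvgB => //; exact: cvg_cst.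
exists Y; split => //; apply/cvg_L2P => e e0.
have [M HM] := cS e e0.
exists M => n Mn.
have -> : sqn P (fun w => S n w - Y w)%R =
    \int[P]_w limn_einf (fun j => (normc (S n w - Z j w) ^+ 2)%:E).
  apply: ae_eq_integral => //.
  - exact: (measurable_EFin_normc_sqr (complex_RVB (mS n) mY)).
  - rewrite (_ : (fun w => _) = (fun w => - limn_esup
        (fun j => - (normc (S n w - Z j w) ^+ 2)%:E))); last first.
      apply/funext => w.
      by rewrite (limn_esupN (fun j => (normc (S n w - Z j w) ^+ 2)%:E)) oppeK.
    apply: measurableT_comp => //; apply: measurable_fun_limn_esup => j.
    apply: measurableT_comp => //.
    exact: (measurable_EFin_normc_sqr (complex_RVB (mS n) (mS _))).
  - apply: filterS Z_cvg => w /(_ n) /cvg_limn_einf_sup[-> _] _.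
    by [].
apply: le_trans (fatou P measurableT _ _) _.
- by move=> j; exact: (measurable_EFin_normc_sqr (complex_RVB (mS n) (mS _))).
- by move=> j w _; rewrite lee_fin sqr_ge0.
apply: (limn_einf_le (N := M)) => j Mj; apply: HM => //.
exact: leq_trans (phij j).
Unshelve. all: by end_near.
Qed.

End completeness.

(** * Sums over residues and characters of Z/qZ *)

Section finite_sums.
Context (V : nmodType).
Implicit Types F : nat -> V.

Lemma sum_nat_mul (a b : nat) F :
  \sum_(0 <= y < a * b) F y =
  \sum_(0 <= j < a) \sum_(0 <= r < b) F (j * b + r)%N.
Proof.
elim: a => [|a IH]; first by rewrite mul0n !big_geq.
rewrite [RHS]big_nat_recr//= -IH mulSn addnC.
rewrite (@big_cat_nat _ _ _ (a * b))//= ?leq_addr//; congr (_ + _).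
by rewrite -{1}[(a * b)%N]add0n big_addn addKn; apply: eq_bigr => r _; rewrite addnC.
Qed.

Lemma sum_dvd (a p : nat) F : (0 < p)%N ->
  \sum_(0 <= k < a * p | (p %| k)%N) F k = \sum_(0 <= j < a) F (j * p)%N.
Proof.
move=> p0; rewrite big_mkcond sum_nat_mul; apply: eq_bigr => j _.
rewrite big_ltn// addn0 dvdn_mull//= -[RHS]addr0; congr (_ + _).
rewrite big_nat big1// => r /andP[r0 rp]; rewrite dvdn_addr ?dvdn_mull//.
by rewrite gtnNdvd//; lia.
Qed.

Lemma sum_level (p m : nat) F : (0 < p ^ m)%N ->
  \sum_(1 <= l < p ^ m | ~~ (p %| l)%N) F l =
  \sum_(0 <= l < p ^ m | ~~ (p %| l)%N) F l.
Proof. by move=> pm0; rewrite [RHS]big_ltn_cond//= dvdn0. Qed.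

(** Every fraction k / p^M in [0, 1) is 0 or has a unique reduced form l / p^m
    with 0 < m <= M: a sum over the characters of Z/p^M is a sum over levels,
    provided that the summand [g m l] depends on l / p^m only. *)
Lemma sum_levels (p M : nat) (g : nat -> nat -> V) : (0 < p)%N ->
  (forall m l, g m.+1 (l * p)%N = g m l) ->
  \sum_(0 <= k < p ^ M) g M k =
  g 0%N 0%N + \sum_(1 <= m < M.+1) \sum_(1 <= l < p ^ m | ~~ (p %| l)%N) g m l.
Proof.
move=> p0 gp; elim: M => [|M IH]; first by rewrite expn0 big_nat1 big_geq// addr0.
rewrite [in RHS]big_nat_recr//= addrA -IH (bigID (fun k => (p %| k)%N))/=.
rewrite sum_level ?expn_gt0 ?p0//; congr (_ + _).
by rewrite expnSr sum_dvd//; apply: eq_bigr => j _; rewrite gp.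
Qed.

(** Multiplication by [q] permutes the residues modulo [n]. *)
Lemma sum_mulmod (q n : nat) F : (0 < n)%N -> coprime q n ->
  \sum_(0 <= y < n) F ((q * y) %% n)%N = \sum_(0 <= y < n) F y.
Proof.
move=> n0 qn; rewrite !big_mkord.
pose h (i : 'I_n) := Ordinal (ltn_pmod (q * i) n0).
rewrite [RHS](reindex_inj (h := h))// => i j /(congr1 val)/= /eqP.
have [ij|/ltnW ij] := leqP j i; last rewrite eq_sym;
  rewrite eqn_mod_dvd ?leq_mul2l ?ij ?orbT// -mulnBr Gauss_dvdr 1?coprime_sym// => nij.
  apply/val_inj/eqP; rewrite eqn_leq ij andbT -subn_eq0.
  by apply: contraLR nij; rewrite -lt0n => ij0; rewrite gtnNdvd//; have := ltn_ord i; lia.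
apply/val_inj/eqP; rewrite eqn_leq ij/= -subn_eq0.
by apply: contraLR nij; rewrite -lt0n => ij0; rewrite gtnNdvd//; have := ltn_ord j; lia.
Qed.

Lemma sum_succ_mod (n : nat) F : (0 < n)%N ->
  \sum_(0 <= y < n) F (y.+1 %% n)%N = \sum_(0 <= y < n) F y.
Proof.
case: n => // n _; rewrite big_nat_recr//= modnn big_nat_recl//= addrC.
by congr (_ + _); apply: eq_big_nat => y /andP[_ yn]; rewrite modn_small.
Qed.

(** The permutation of [sum_mulmod] preserves divisibility by [p], hence permutes
    the units modulo [p ^ m]. *)
Lemma sum_level_mulmod (p q m : nat) F : prime p -> prime q -> q <> p ->
  (0 < m)%N ->
  \sum_(1 <= l < p ^ m | ~~ (p %| l)%N) F ((q * l) %% p ^ m)%N =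
  \sum_(1 <= l < p ^ m | ~~ (p %| l)%N) F l.
Proof.
move=> pp pq qp m0; have pm0 : (0 < p ^ m)%N by rewrite expn_gt0 prime_gt0.
have copq : coprime q (p ^ m).
  by rewrite coprimeXr// prime_coprime// dvdn_prime2//; apply/eqP.
rewrite !sum_level// !(big_mkcond (fun l => ~~ _)).
rewrite -[RHS](sum_mulmod _ pm0 copq); apply: eq_bigr => l _.
have -> // : (p %| (q * l) %% p ^ m)%N = (p %| l)%N.
rewrite /dvdn modn_dvdm -/(p %| _)%N ?dvdn_exp//.
by rewrite Gauss_dvdr// coprime_sym prime_coprime// dvdn_prime2//; apply/eqP.
Qed.

End finite_sums.

Section characters.
Context (R : realType).

Lemma e_0 : e_ 0 = 1 :> R[i].
Proof. by rewrite /e_ mulr0 cos0 sin0. Qed.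

Lemma e_D (x y : R) : e_ (x + y) = e_ x * e_ y.
Proof.
rewrite /e_ mulrDr cosD sinD; congr Complex.
by rewrite addrC.
Qed.

Lemma conjc_e (x : R) : conjc (e_ x) = e_ (- x).
Proof. by rewrite /e_ mulrN cosN sinN. Qed.

Lemma conjcM (z w : R[i]) : conjc (z * w) = conjc z * conjc w.
Proof. exact: (rmorphM (@conjc R)). Qed.

Lemma normc_e (x : R) : normc (e_ x) = 1.
Proof. by rewrite /e_ /= cos2Dsin2 sqrtr1. Qed.

Lemma e_N (x : R) : e_ (- x) = (e_ x)^-1.
Proof.
have e0 : e_ x != 0.
  by apply/negP => /eqP/(congr1 (@normc R)); rewrite normc_e normc0 => /eqP; rewrite oner_eq0.
by apply: (mulfI e0); rewrite divff// -e_D subrr e_0.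
Qed.

Lemma e_nat (n : nat) : e_ (n%:R : R) = 1.
Proof.
elim: n => [|n IH]; first exact: e_0.
rewrite -natr1 e_D IH mul1r /e_ mulr1 [2 * pi]mulrC mulr_natr.
by rewrite cos2pi sin2pi.
Qed.

Lemma e_muln (x : R) (n : nat) : e_ (x * n%:R) = e_ x ^+ n.
Proof.
elim: n => [|n IH]; first by rewrite mulr0 e_0 expr0.
by rewrite -natr1 mulrDr mulr1 e_D IH exprSr.
Qed.

(** e(x) = 1 would give sin (pi x) = 0, which is impossible for 0 < x < 1. *)
Lemma e_neq1 (x : R) : 0 < x < 1 -> e_ x != 1.
Proof.
move=> /andP[x0 x1]; apply/eqP => /(congr1 (@complex.Re R)) /= cos1.
have : 0 < sin (pi * x).
  apply: sin_gt0_pi; rewrite mulr_gt0 ?pi_gt0//=.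
  by rewrite gtr_pMr ?pi_gt0.
suff -> : sin (pi * x) = 0 by rewrite ltxx.
move: cos1; rewrite (_ : 2 * pi * x = (pi * x) *+ 2); last by ring.
rewrite cos_mulr2n cos2sin2 => h.
by apply/eqP; rewrite -sqrf_eq0; apply/eqP; lra.
Qed.

Lemma e_inj (x y : R) : 0 <= x < 1 -> 0 <= y < 1 -> e_ x = e_ y -> x = y.
Proof.
wlog xy : x y / x <= y.
  move=> W hx hy exy; have [xy|/ltW yx] := leP x y; first exact: W.
  by apply/esym/W.
move=> /andP[x0 x1] /andP[y0 y1] exy; apply/eqP; rewrite eq_le xy/= leNgt.
apply/negP => xy'; have /negP[] : e_ (y - x) != 1 by apply: e_neq1; lra.
by rewrite e_D e_N exy -e_N -e_D subrr e_0.
Qed.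

(** The characters of Z/qZ, indexed and evaluated at natural numbers; only the
    residues of [l] and [y] modulo [q] matter. *)
Definition chi (q l y : nat) : R[i] := e_ ((y * l)%:R / q%:R).

Lemma chi0 q l : chi q l 0 = 1.
Proof. by rewrite /chi mul0n mul0r e_0. Qed.

Lemma chi_0l q y : chi q 0 y = 1.
Proof. by rewrite /chi muln0 mul0r e_0. Qed.

Lemma chiD q l y z : chi q l (y + z) = chi q l y * chi q l z.
Proof. by rewrite /chi mulnDl natrD mulrDl e_D. Qed.

Lemma chiS q l y : chi q l y.+1 = chi q l y * e_ (l%:R / q%:R).
Proof. by rewrite -addn1 chiD /chi mul1n. Qed.

Lemma chi_sym q l y : chi q l y = chi q y l.
Proof. by rewrite /chi mulnC. Qed.

Lemma chi_mulr q l y z : chi q l (y * z) = chi q (y * l) z.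
Proof. by rewrite /chi mulnAC mulnC [(y * l)%N]mulnC mulnA. Qed.

Definition chibar (q l y : nat) : R[i] := conjc (chi q l y).

Lemma chi_chibar q l y : chi q l y * chibar q l y = 1.
Proof. by rewrite /chibar /chi conjc_e -e_D subrr e_0. Qed.

Lemma normc_chibar q l y : normc (chibar q l y) = 1.
Proof. by rewrite /chibar /chi conjc_e normc_e. Qed.

Lemma chibarS q l y : e_ (l%:R / q%:R) * chibar q l y.+1 = chibar q l y.
Proof. by rewrite /chibar chiS conjcM mulrCA (conjc_e (l%:R / q%:R)) -e_D subrr e_0 mulr1. Qed.

Lemma chibarDl q k l y : chibar q (k + l) y = chibar q k y * chibar q l y.
Proof.
by rewrite /chibar chi_sym chiD conjcM [chi q y k]chi_sym [chi q y l]chi_sym.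
Qed.

Lemma chi_dvd q l y : (0 < q)%N -> (q %| y)%N -> chi q l y = 1.
Proof.
move=> q0 /dvdnP[k ->]; rewrite /chi mulnAC natrM mulfK ?e_nat//.
by rewrite pnatr_eq0 -lt0n.
Qed.

Lemma chi_modr q l y : (0 < q)%N -> chi q l (y %% q) = chi q l y.
Proof. move=> q0; rewrite [in RHS](divn_eq y q) chiD.
by rewrite (@chi_dvd q l (y %/ q * q))// ?mul1r// dvdn_mull. Qed.

Lemma chi_modl q l y : (0 < q)%N -> chi q (l %% q) y = chi q l y.
Proof. by move=> q0; rewrite chi_sym chi_modr// chi_sym. Qed.

Lemma chi_scale q r l y : (0 < r)%N -> chi (q * r) (l * r) y = chi q l y.
Proof.
move=> r0; rewrite /chi mulnA !natrM -mulf_div divff ?mulr1//.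
by rewrite pnatr_eq0 -lt0n.
Qed.

Lemma chi_scaler q r l y : (0 < r)%N -> chi (q * r) l (r * y) = chi q l y.
Proof. by move=> r0; rewrite chi_mulr [(r * l)%N]mulnC chi_scale. Qed.

Lemma chi_addl q l y t : (0 < q)%N -> chi q (t * q + l) y = chi q l y.
Proof. by move=> q0; rewrite -chi_modl// modnMDl chi_modl. Qed.

Lemma chi1_inj q y z : (0 < q)%N -> chi q 1 y = chi q 1 z -> y = z %[mod q].
Proof.
move=> q0; rewrite -chi_modr// -[in RHS]chi_modr// /chi !muln1 => /e_inj h.
have qR : (0 : R) < q%:R by rewrite ltr0n.
have bd n : 0 <= ((n %% q)%:R / q%:R : R) < 1.
  by rewrite divr_ge0//= ltr_pdivrMr// mul1r ltr_nat ltn_pmod.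
have /(congr1 (fun t => t * q%:R)) := h (bd y) (bd z).
by rewrite !divfK ?gt_eqF// => /eqP; rewrite eqr_nat => /eqP.
Qed.

(** Orthogonality of characters, as a geometric sum of q-th roots of unity. *)
Lemma sum_chi_chibar q y z : (0 < q)%N ->
  \sum_(0 <= k < q) chi q k y * chibar q k z =
  if y == z %[mod q] then q%:R else 0.
Proof.
move=> q0; pose u := chi q 1 y * chibar q 1 z.
have uE k : chi q k y * chibar q k z = u ^+ k.
  have chiX t : chi q k t = chi q 1 t ^+ k.
    by rewrite /chi muln1 natrM mulrAC e_muln.
  by rewrite /u /chibar !chiX rmorphXn exprMn.
under eq_bigr do rewrite uE.
have uq : u ^+ q = 1.
  have chiq t : chi q q t = 1 by rewrite chi_sym chi_dvd ?dvdnn.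
  by rewrite -uE /chibar !chiq conjc1 mulr1.
case: ifPn => [/eqP yz|yz].
  rewrite (_ : u = 1); last by rewrite /u -chi_modr// yz chi_modr// chi_chibar.
  by under eq_bigr do rewrite expr1n; rewrite big_mkord sumr_const card_ord.
have u1 : u - 1 != 0.
  rewrite subr_eq0; apply: contra yz => /eqP u1; apply/eqP/chi1_inj => //.
  have := congr1 (fun t => t * chi q 1 z) u1.
  by rewrite /u mul1r -mulrA [chibar _ _ _ * _]mulrC chi_chibar mulr1.
apply: (mulfI u1); rewrite mulr0 big_mkord -subrX1 uq subrr//.
Qed.

End characters.

Arguments chi : simpl never.
Arguments chibar : simpl never.

(** * Scaling function and spectral families *)

Section scaling_function.
Context (R : realType) (p : nat) (H : R).

(** The norm of [n] is a power of 1/p, hence the scaling function is a power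
    of [ratio] = p^(-H), see [scalingE]; this makes its multiplicativity and its
    size visible. *)
Definition scaling (n : nat) : R := powR (padic_norm R p n) H.

Definition ratio : R := powR p%:R (- H).

Lemma scalingE n : scaling n = ratio ^+ logn p n.
Proof.
rewrite /scaling /padic_norm -exprVn.
have pV : powR (p%:R^-1 : R) H = ratio.
  by rewrite -powR_inv1 ?ler0n// -powRrM mulN1r.
elim: (logn p n) => [|k IH]; first by rewrite !expr0 powR1.
by rewrite !exprS powRM ?exprn_ge0 ?invr_ge0 ?ler0n// IH pV.
Qed.

Lemma scaling1 : scaling 1 = 1.
Proof. by rewrite scalingE logn1. Qed.

Lemma scalingM m n : (0 < m)%N -> (0 < n)%N ->
  scaling (m * n) = scaling m * scaling n.
Proof. by move=> m0 n0; rewrite !scalingE lognM// exprD. Qed.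

Hypothesis p_prime : prime p.

Lemma ratio_gt0 : 0 < ratio.
Proof. by rewrite powR_gt0// ltr0n prime_gt0. Qed.

Lemma ratio_lt1 : 0 < H -> ratio < 1.
Proof.
move=> H0; rewrite /ratio powRN invf_lt1 ?powR_gt0 ?ltr0n ?prime_gt0//.
have := @gt0_ltr_powR R H H0 1 p%:R.
by rewrite powR1; apply; rewrite ?nnegrE// ltr1n prime_gt1.
Qed.

Lemma scaling_gt0 n : 0 < scaling n.
Proof. by rewrite scalingE exprn_gt0// ratio_gt0. Qed.

Lemma scaling_prime q : prime q -> q <> p -> scaling q = 1.
Proof.
by move=> pq /eqP qp; rewrite scalingE logn_prime// eq_sym (negPf qp).
Qed.

Lemma scaling_p : scaling p = ratio.
Proof. by rewrite scalingE logn_prime// eqxx. Qed.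

Lemma scaling_le n M : 0 < H -> (0 < n)%N -> (p ^ M %| n)%N ->
  scaling n <= ratio ^+ M.
Proof.
move=> H0 n0; rewrite pfactor_dvdn// => Mn; rewrite scalingE.
by rewrite ler_wiXn2l// ltW ?ratio_gt0 ?ratio_lt1.
Qed.

End scaling_function.

Section spectral_families.
Context d (T : measurableType d) (R : realType) (P : probability T R) (p : nat).
Implicit Types A B : nat -> nat -> T -> R[i].

Definition valid_index (m l : nat) :=
  [&& 0 < m, 0 < l, l < p ^ m & ~~ (p %| l)]%N.

(** A functional of a spectral family is a double sum over naturals, some of
    which are not spectral indices; the value 0 there is arbitrary. *)
Definition extend (f : spectral_index p -> R[i]) (m l : nat) : R[i] :=
  if insub (m, l) is Some i then f i else 0.

Lemma extend_on_index A w m l :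
  valid_index m l -> extend ((on_index p A)^~ w) m l = A m l w.
Proof. by move=> v; rewrite /extend insubT. Qed.

Lemma on_index_RV A :
  (forall i, complex_RV (on_index p A i)) <->
  (forall m l, valid_index m l -> complex_RV (A m l)).
Proof.
split=> [mA m l v|mA [[m l] v]]; last exact: mA.
exact: (mA (exist _ (m, l) v)).
Qed.

(** Uniqueness of the reduced form l / p^m. *)
Lemma index_frequency_inj m l m' l' : prime p ->
  valid_index m l -> valid_index m' l' ->
  l%:R / (p ^ m)%:R = l'%:R / (p ^ m')%:R :> R -> (m, l) = (m', l').
Proof.
move=> p_prime; wlog mm' : m l m' l' / (m <= m')%N.
  move=> W v v' e; have [mm'|/ltnW mm'] := leqP m m'; first exact: W.
  by apply/esym/W.
move=> /and4P[m0 l0 lp pl] /and4P[m0' l0' lp' pl'] e.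
have nz k : (p ^ k)%:R != 0 :> R.
  by rewrite pnatr_eq0 -lt0n expn_gt0 prime_gt0.
have {}e : (l * p ^ (m' - m) = l')%N.
  apply/eqP; rewrite -(eqr_nat R) natrM; apply/eqP.
  have := congr1 (fun t : R => t * (p ^ m')%:R) e.
  rewrite divfK// => <-; rewrite -{2}(subnK mm') expnD natrM [_ * (p ^ m)%:R]mulrC.
  by rewrite mulrA divfK.
have m'm : (m' - m = 0)%N.
  apply/eqP; apply: contraT; rewrite -lt0n => h.
  by move: pl'; rewrite -e dvdn_mull// dvdn_exp.
move: e; rewrite m'm expn0 muln1 => ->; congr (_, _).
by apply/eqP; rewrite eqn_leq mm'/= -subn_eq0 m'm.
Qed.

Lemma valid_in_sum (m M l : nat) : (1 <= m < M.+1)%N -> (1 <= l < p ^ m)%N ->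
  ~~ (p %| l)%N -> valid_index m l.
Proof. by move=> /andP[m0 _] /andP[l0 lp] pl; rewrite /valid_index m0 l0 lp pl. Qed.

Lemma eq_level_sum (V : nmodType) (F G : nat -> nat -> V) M :
  (forall m l, valid_index m l -> F m l = G m l) ->
  \sum_(1 <= m < M.+1) \sum_(1 <= l < p ^ m | ~~ (p %| l)%N) F m l =
  \sum_(1 <= m < M.+1) \sum_(1 <= l < p ^ m | ~~ (p %| l)%N) G m l.
Proof.
move=> FG; apply: eq_big_nat => m mM.
rewrite big_nat_cond [RHS]big_nat_cond; apply: eq_bigr => l /andP[lp pl].
exact/FG/(valid_in_sum mM).
Qed.

Lemma complex_RV_level_sum d' (S : measurableType d') (F : nat -> nat -> S -> R[i]) M :
  (forall m l, valid_index m l -> complex_RV (F m l)) ->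
  complex_RV (fun w =>
    \sum_(1 <= m < M.+1) \sum_(1 <= l < p ^ m | ~~ (p %| l)%N) F m l w).
Proof.
move=> mF; under eq_fun do rewrite big_nat_cond.
apply: complex_RV_sum => m /andP[mM _].
under eq_fun do rewrite big_nat_cond.
by apply: complex_RV_sum => l /andP[lp pl]; exact/mF/(valid_in_sum mM).
Qed.

(** The partial sums, for all orders together, are measurable functionals of
    the spectral family, so that [eq_dist_cvg_L2] applies. *)
Lemma eq_dist_expansion (I : countType) A B (c : I -> nat -> nat -> R[i])
    (Y Z : I -> T -> R[i]) :
  (forall i, complex_RV (on_index p A i)) ->
  (forall i, complex_RV (on_index p B i)) ->
  (forall i, complex_RV (Y i)) -> (forall i, complex_RV (Z i)) ->
  complex_eq_dist P (on_index p A) (on_index p B) ->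
  (forall i, cvg_L2 P (fun M w =>
    \sum_(1 <= m < M.+1) \sum_(1 <= l < p ^ m | ~~ (p %| l)%N)
      A m l w * c i m l) (Y i)) ->
  (forall i, cvg_L2 P (fun M w =>
    \sum_(1 <= m < M.+1) \sum_(1 <= l < p ^ m | ~~ (p %| l)%N)
      B m l w * c i m l) (Z i)) ->
  complex_eq_dist P Y Z.
Proof.
move=> /on_index_RV mA /on_index_RV mB mY mZ AB AY BZ.
apply: (eq_dist_cvg_L2 _ _ mY mZ AY BZ).
- move=> M i; apply: complex_RV_level_sum => m l v.
  by apply: complex_RVM; [exact: mA|exact: complex_RV_cst].
- move=> M i; apply: complex_RV_level_sum => m l v.
  by apply: complex_RVM; [exact: mB|exact: complex_RV_cst].
pose F (k : nat * I) (f : spectral_index p -> R[i]) :=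
  \sum_(1 <= m < k.1.+1) \sum_(1 <= l < p ^ m | ~~ (p %| l)%N)
    extend f m l * c k.2 m l.
have mF k : complex_RV (fun f : complex_space R (spectral_index p) =>
    F k (fun i => entry i f)).
  apply: complex_RV_level_sum => m l v; apply: complex_RVM; last exact: complex_RV_cst.
  rewrite /extend insubT; exact: complex_RV_entry.
have FE (U : nat -> nat -> T -> R[i]) k : (fun w => F k ((on_index p U)^~ w)) = fun w =>
    \sum_(1 <= m < k.1.+1) \sum_(1 <= l < p ^ m | ~~ (p %| l)%N)
      U m l w * c k.2 m l.
  apply/funext => w; apply: eq_level_sum => m l v.
  by rewrite extend_on_index.
have := complex_eq_dist_map mF AB.
by rewrite (funext (FE A)) (funext (FE B)).
Qed.

End spectral_families.

(** * From the spectral sequence to the process *)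

Section from_spectrum_to_process.
Context d (T : measurableType d) (R : realType) (P : probability T R) (p : nat)
  (H : R) (X : nat -> {RV P >-> R}) (A : nat -> nat -> T -> R[i]).
Hypothesis p_prime : prime p.
Hypothesis A_RV : forall i, complex_RV (on_index p A i).
Hypothesis A_expansion : forall n : nat,
  cvg_L2 P (partial_expansion p A n) (fun w => Complex (X n w) 0).
Hypothesis A_rotation : complex_eq_dist P (on_index p A)
  (on_index p (fun m l w => e_ (l%:R / (p ^ m)%:R : R) * A m l w)).
Hypothesis A_multiplication : forall q : nat, prime q -> q <> p ->
  complex_eq_dist P (on_index p A)
    (on_index p (fun m l => A m ((q * l) %% p ^ m)%N)).
Hypothesis A_trace : complex_eq_dist P
  (on_index p (fun m l w => Complex (powR p%:R (- H)) 0 * A m l w))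
  (on_index p (fun m l w => \sum_(0 <= t < p) A m.+1 (t * p ^ m + l)%N w)).

Let x n w := Complex (X n w) 0.

Let x_RV n : complex_RV (x n).
Proof. exact: complex_RV_real. Qed.

Let mA : forall m l, valid_index p m l -> complex_RV (A m l).
Proof. exact/on_index_RV. Qed.

Let pm_gt0 m : (0 < p ^ m)%N.
Proof. by rewrite expn_gt0 prime_gt0. Qed.

Lemma partial_expansion_RV n M : complex_RV (partial_expansion p A n M).
Proof.
apply: complex_RV_level_sum => m l v.
by apply: complex_RVM; [exact: mA|exact: complex_RV_cst].
Qed.

(** Iterating the rotation invariance: multiplication by e(k l / p^m) is the
    spectral counterpart of the translation by [k]. *)
Lemma rotation_iter k : complex_eq_dist P (on_index p A)
  (on_index p (fun m l w => chi R (p ^ m) l k * A m l w)).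
Proof.
elim: k => [|k IH].
  rewrite (_ : (fun m l w => _) = A)//.
  by apply/funext => m; apply/funext => l; apply/funext => w; rewrite chi0 mul1r.
apply: complex_eq_dist_trans IH _.
have := @complex_eq_dist_map _ T R P _ _ (fun (i : spectral_index p)
  (f : spectral_index p -> R[i]) =>
  chi R (p ^ (val i).1) (val i).2 k * f i) _ _ _ A_rotation.
rewrite (_ : (fun j w => _ * on_index p (fun m l w => e_ _ * _) j w) =
  on_index p (fun m l w => chi R (p ^ m) l k.+1 * A m l w)).
  by apply => j; apply: complex_RVZ; exact: complex_RV_entry.
apply/funext => j; apply/funext => w.
by rewrite /on_index chiS mulrA.
Qed.

Lemma increment_expansion n : cvg_L2 P (fun M w =>
    \sum_(1 <= m < M.+1) \sum_(1 <= l < p ^ m | ~~ (p %| l)%N)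
      A m l w * (chi R (p ^ m) l n.+1 - chi R (p ^ m) l n))
  (fun w => x n.+1 w - x n w).
Proof.
have -> : (fun w => x n.+1 w - x n w) = (fun w => x n.+1 w + (-1) * x n w).
  by apply/funext => w; rewrite mulN1r.
rewrite (_ : (fun M w => _) = (fun M w => partial_expansion p A n.+1 M w +
   (-1) * partial_expansion p A n M w)).
  apply: cvg_L2D => //.
  - by move=> M; exact: partial_expansion_RV.
  - by move=> M; apply: complex_RVZ; exact: partial_expansion_RV.
  - exact: complex_RVZ.
  - apply: cvg_L2Z => // M; exact: partial_expansion_RV.
apply/funext => M; apply/funext => w; rewrite /partial_expansion mulN1r -sumrB.
apply: eq_bigr => m _; rewrite -sumrB; apply: eq_bigr => l _.
by rewrite -mulrBr; congr (_ * _); rewrite opprB addrA subrK.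
Qed.

(** The increment at [n + k] is obtained from the one at [n] by rotating each
    coefficient by e(k l / p^m). *)
Lemma stationary_increments_of_spectrum k :
  eq_dist P (fun m w => X m.+1 w - X m w : measurableTypeR R)
            (fun m w => X (m + k).+1 w - X (m + k)%N w).
Proof.
apply/complex_eq_distP.
have E n w : Complex (X n.+1 w - X n w) 0 = x n.+1 w - x n w.
  by rewrite /x; apply/eqP; rewrite eq_complex/= oppr0 addr0 !eqxx.
rewrite (_ : (fun n w => _) = (fun n w => x n.+1 w - x n w)); last first.
  by apply/funext => n; apply/funext => w; exact: E.
rewrite [X in complex_eq_dist _ _ X](_ : _ =
    (fun n w => x (n + k).+1 w - x (n + k)%N w)); last first.
  by apply/funext => n; apply/funext => w; exact: E.
apply: (eq_dist_expansion A_RV _ _ _ (rotation_iter k)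
  (c := fun n m l => chi R (p ^ m) l n.+1 - chi R (p ^ m) l n)).
- apply/on_index_RV => m l v; apply: complex_RVZ; exact: mA.
- by move=> n; exact: complex_RVB.
- by move=> n; exact: complex_RVB.
- by move=> n; exact: increment_expansion.
move=> n; rewrite (_ : (fun M w => _) = (fun M w =>
    \sum_(1 <= m < M.+1) \sum_(1 <= l < p ^ m | ~~ (p %| l)%N)
      A m l w * (chi R (p ^ m) l (n + k).+1 - chi R (p ^ m) l (n + k)))).
  exact: increment_expansion.
apply/funext => M; apply/funext => w.
apply: eq_bigr => m _; apply: eq_bigr => l _.
rewrite -addSn !chiD -mulrBl mulrAC mulrC; congr (_ * _); exact: mulrC.
Qed.

(** In X_{q n} each character l is evaluated at q n, that is, the character
    q l at n; relabelling the coefficients by l |-> q l gives back X_n. *)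
Lemma prime_scaling_of_spectrum q : prime q -> q <> p ->
  complex_eq_dist P (fun n => x (q * n)%N) x.
Proof.
move=> pq qp.
apply: (eq_dist_expansion A_RV _ _ _ (A_multiplication pq qp)
  (c := fun n m l => chi R (p ^ m) l (q * n) - 1)) => //.
  apply/on_index_RV => m l /and4P[m0 l0 lp pl]; apply: mA.
  have pql : ~~ (p %| (q * l) %% p ^ m)%N.
    rewrite /dvdn modn_dvdm -/(p %| _)%N; last by rewrite dvdn_exp.
    by rewrite Euclid_dvdM// negb_or pl andbT dvdn_prime2//; apply/eqP/nesym.
  rewrite /valid_index m0 pql ltn_pmod//= lt0n !andbT.
  by apply: contra pql => /eqP ->; rewrite dvdn0.
  by move=> n; exact: (A_expansion (q * n)).
move=> n; rewrite (_ : (fun M w => _) = partial_expansion p A n)//.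
apply/funext => M; apply/funext => w.
apply: eq_big_nat => m /andP[m0 _].
rewrite -[RHS](sum_level_mulmod (fun l => A m l w * (chi R (p ^ m) l n - 1))
  p_prime pq qp m0)/=.
apply: eq_bigr => l _; congr (_ * (_ - _)).
by rewrite chi_modl// -chi_mulr.
Qed.

(** At p n a character of level m + 1 reduces to one of level m, the same for
    the p indices t p^m + l; the characters of level 1 become trivial and drop
    out. *)
Lemma p_scaling_of_spectrum :
  complex_eq_dist P (fun n => x (p * n)%N)
    (fun n w => Complex (powR p%:R (- H)) 0 * x n w).
Proof.
apply: complex_eq_dist_sym.
have valid_lift m l t : valid_index p m l -> (t < p)%N ->
    valid_index p m.+1 (t * p ^ m + l).
  move=> /and4P[m0 l0 lp pl] tp; apply/and4P; split => //.
  - by rewrite addn_gt0 l0 orbT.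
  - rewrite expnS (@leq_trans (t.+1 * p ^ m))// ?leq_mul2r ?tp ?orbT//.
    by rewrite mulSn addnC ltn_add2r.
  - by rewrite dvdn_addr// dvdn_mull// dvdn_exp.
apply: (eq_dist_expansion _ _ _ _ A_trace
  (c := fun n m l => chi R (p ^ m) l n - 1)) => //.
- apply/on_index_RV => m l v; apply: complex_RVZ; exact: mA.
- apply/on_index_RV => m l v; under eq_fun do rewrite big_mkord.
  by apply: complex_RV_sum => t _; exact/mA/valid_lift.
- by move=> n; exact: complex_RVZ.
- move=> n; rewrite (_ : (fun M w => _) = (fun M w =>
      Complex (powR p%:R (- H)) 0 * partial_expansion p A n M w)).
    by apply: cvg_L2Z => // M; exact: partial_expansion_RV.
  apply/funext => M; apply/funext => w; rewrite /partial_expansion mulr_sumr.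
  apply: eq_bigr => m _; rewrite mulr_sumr; apply: eq_bigr => l _.
  by rewrite mulrA.
move=> n; have := cvg_L2_shift 1 (A_expansion (p * n)).
rewrite (_ : (fun M => partial_expansion p A (p * n) (M + 1)) = (fun M w =>
  \sum_(1 <= m < M.+1) \sum_(1 <= l < p ^ m | ~~ (p %| l)%N)
   (\sum_(0 <= t < p) A m.+1 (t * p ^ m + l)%N w) * (chi R (p ^ m) l n - 1)))//.
apply/funext => M; apply/funext => w; rewrite /partial_expansion addn1.
(* Level 1: p n l / p is an integer. *)
rewrite big_nat_recl//= [X in X + _]big1 ?add0r; last first.
  by move=> l _; rewrite -/(chi R (p ^ 1) l (p * n)) chi_dvd ?subrr ?mulr0// expn1 dvdn_mulr.
apply: eq_big_nat => m /andP[m0 _].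
rewrite sum_level// expnS big_mkcond sum_nat_mul/=.
under [RHS]eq_bigr => l _ do rewrite mulr_suml.
rewrite [RHS]exchange_big/=; apply: eq_bigr => t _.
rewrite [RHS]sum_level// [RHS]big_mkcond/=; apply: eq_bigr => l _.
rewrite dvdn_addr; last by rewrite dvdn_mull// dvdn_exp.
case: ifP => // _; congr (_ * (_ - _)).
rewrite -/(chi R (p * p ^ m) (t * p ^ m + l) (p * n)) [(p * p ^ m)%N]mulnC.
by rewrite chi_scaler ?prime_gt0// chi_addl.
Qed.

(** Split off one prime factor of [n] at a time, the scaling function being
    multiplicative. *)
Lemma scaling_of_spectrum n : (0 < n)%N ->
  complex_eq_dist P (fun m => x (n * m)%N)
    (fun m w => Complex (scaling p H n) 0 * x m w).
Proof.
elim/ltn_ind: n => n IH n0.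
have [n1|n1] := leqP n 1.
  have -> : n = 1%N by apply/eqP; rewrite eqn_leq n1 n0.
  rewrite scaling1 (_ : (fun m => x (1 * m)%N) = (fun m w => Complex 1 0 * x m w))//.
  by apply/funext => m; apply/funext => w; rewrite mul1n -[Complex 1 0]/(1 : R[i]) mul1r.
pose q := pdiv n; have pq : prime q by exact: pdiv_prime.
have nE : n = (q * (n %/ q))%N by rewrite mulnC divnK// pdiv_dvd.
have q0 : (0 < q)%N by exact: prime_gt0.
have n'0 : (0 < n %/ q)%N by move: n0; rewrite {1}nE muln_gt0 => /andP[].
have n'n : (n %/ q < n)%N by rewrite ltn_Pdiv// prime_gt1.
have {}IH := IH _ n'n n'0.
have xq : complex_eq_dist P (fun m => x (q * m)%N)
    (fun m w => Complex (scaling p H q) 0 * x m w).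
  have [->|/eqP qp] := eqVneq q p.
    by rewrite scaling_p//; exact: p_scaling_of_spectrum.
  rewrite scaling_prime// (_ : (fun m w => Complex 1 0 * x m w) = x).
    exact: prime_scaling_of_spectrum.
  by apply/funext => m; apply/funext => w; rewrite -[Complex 1 0]/(1 : R[i]) mul1r.
rewrite nE scalingM//; move: (n %/ q)%N IH => n' IH.
have step1 := @complex_eq_dist_map _ T R P _ _ (fun (m : nat)
  (f : nat -> R[i]) => f (n' * m)%N) _ _ (fun m => complex_RV_entry _) xq.
have step2 := @complex_eq_dist_map _ T R P _ _ (fun (m : nat)
  (f : nat -> R[i]) => Complex (scaling p H q) 0 * f m) _ _
  (fun m => complex_RVZ _ (complex_RV_entry _)) IH.
have := complex_eq_dist_trans step1 step2.
rewrite (_ : (fun m w => x (q * (n' * m))%N w) = (fun m => x (q * n' * m)%N)); last first.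
  by apply/funext => m; rewrite mulnA.
rewrite (_ : (fun m w => _ * (_ * x m w)) =
  (fun m w => Complex (scaling p H q * scaling p H n') 0 * x m w))//.
apply/funext => m; apply/funext => w; rewrite mulrA; congr (_ * _).
by apply/eqP; rewrite eq_complex/= !mulr0 mul0r subr0 addr0 !eqxx.
Qed.

End from_spectrum_to_process.

(** * Laws invariant under a contraction *)

Section self_similar_at_zero.
Context d (T : measurableType d) (R : realType) (P : probability T R).

(** P(|Y| > e) = P(r^k |Y| > e) for all k, and the events on the right decrease
    to the empty set. *)
Lemma contracting_law_ae0 (Y : T -> R) (r : R) :
  measurable_fun setT Y -> 0 < r < 1 ->
  (forall k B, measurable B ->
     P [set w | B (Y w)] = P [set w | B (r ^+ k * Y w)]) ->
  \forall w \ae P, Y w = 0.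
Proof.
move=> mY /andP[r0 r1] law.
have mgt (Z : T -> R) e : measurable_fun setT Z ->
    measurable [set w | e < `|Z w|].
  move=> mZ; have : measurable_fun setT (fun w => `|Z w|).
    exact: measurableT_comp.
  move=> /(_ measurableT `]e, +oo[%classic (measurable_itv _)).
  rewrite setTI; congr measurable.
  by apply/seteqP; split => w /=; rewrite in_itv/= andbT.
have null e : 0 < e -> P [set w | e < `|Y w|] = 0%E.
  move=> e0; pose E k := [set w | e < `|r ^+ k * Y w|].
  have mE k : measurable (E k) by apply: mgt; exact: measurable_funM.
  have PE k : P (E k) = P [set w | e < `|Y w|].
    have mB : measurable [set t : R | e < `|t|].
      have := @normr_measurable R setT measurableT `]e, +oo[%classic (measurable_itv _).
      rewrite setTI; congr measurable.
      by apply/seteqP; split => w /=; rewrite in_itv/= andbT.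
    by rewrite (law k _ mB).
  have capE : \bigcap_n E n = set0.
    apply/seteqP; split => // w Ew.
    have : geometric (Y w) r k @[k --> \oo] --> 0.
      by apply: cvg_geometric; rewrite ger0_norm// ltW.
    move=> /cvgrPdist_lt/(_ _ e0)[k _ /(_ k (leqnn k))].
    rewrite /= sub0r normrN mulrC ltNge => /negP; apply.
    exact/ltW/(Ew k I).
  have : P (E n) @[n --> \oo] --> P (\bigcap_n E n).
    apply: nonincreasing_cvg_mu => //.
    - by rewrite (le_lt_trans (probability_le1 _ _))// ltry.
    - exact: bigcapT_measurable.
    - move=> n m nm; apply/subsetPset => w /= ew.
      apply: (lt_le_trans ew); rewrite !normrM ler_wpM2r//.
      by rewrite !ger0_norm ?exprn_ge0 ?(ltW r0)// ler_wiXn2l// ltW.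
  rewrite capE measure0; under eq_fun do rewrite PE.
  by move/cvg_lim => <-//; rewrite lim_cst.
(* Countably many thresholds exhaust the event that Y is nonzero. *)
have nullU : \forall w \ae P, forall n : nat, ~ (n.+1%:R^-1 < `|Y w|).
  apply: ae_foralln => n; exists [set w | n.+1%:R^-1 < `|Y w|]; split.
  - exact: mgt.
  - by apply: null; rewrite invr_gt0.
  - by move=> w /= /contrapT.
apply: filterS nullU => w Yw; apply/eqP; apply: contraT => Y0.
exfalso; apply: (Yw (Num.truncn `|Y w|^-1)).
by rewrite invf_plt ?posrE ?normr_gt0// truncnS_gt.
Qed.

End self_similar_at_zero.

(** * From the process to the spectral sequence *)

Section means.
Context (R : realType).
Implicit Types F : nat -> R[i].

(** Averages stand for integrals over Z_p: those over y < p ^ N are its Haar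
    integrals of the functions that are periodic modulo p ^ N. *)
Definition mean (n : nat) F : R[i] := n%:R^-1 * \sum_(0 <= y < n) F y.

Lemma natrC_neq0 n : (0 < n)%N -> n%:R != 0 :> R[i].
Proof. by rewrite pnatr_eq0 -lt0n. Qed.

Lemma eq_mean n F G : (forall y, (y < n)%N -> F y = G y) -> mean n F = mean n G.
Proof. by move=> FG; congr (_ * _); apply: eq_big_nat => y /andP[_]; exact: FG. Qed.

Lemma meanB n F G : mean n F - mean n G = mean n (fun y => F y - G y).
Proof. by rewrite /mean -mulrBr sumrB. Qed.

Lemma meanZ n c F : c * mean n F = mean n (fun y => c * F y).
Proof. by rewrite /mean mulrCA mulr_sumr. Qed.

Lemma mean_cst n c : (0 < n)%N -> mean n (fun _ => c) = c.
Proof.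
move=> n0; rewrite /mean big_mkord sumr_const card_ord -[c *+ n]mulr_natl mulKf//.
exact: natrC_neq0.
Qed.

Lemma mean_mul a b F : mean (a * b) F =
  mean a (fun j => mean b (fun r => F (j * b + r)%N)).
Proof.
by rewrite /mean sum_nat_mul natrM invfM -mulrA [b%:R^-1 * _]mulr_sumr.
Qed.

(** The Haar integral of a locally constant function does not depend on the
    level at which it is computed. *)
Lemma mean_periodic a b F : (0 < b)%N -> (0 < a)%N ->
  (forall y, F (y %% a)%N = F y) -> mean (b * a) F = mean a F.
Proof.
move=> b0 a0 Fa; rewrite mean_mul -[RHS](mean_cst _ b0).
apply: eq_mean => j _; apply: eq_mean => r ra.
by rewrite -Fa modnMDl modn_small.
Qed.

End means.

Section means_of_random_variables.
Context d (T : measurableType d) (R : realType) (P : probability T R).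

Lemma mean_RV n (Z : nat -> T -> R[i]) : (forall y, complex_RV (Z y)) ->
  complex_RV (fun w => mean n (fun y => Z y w)).
Proof. by move=> mZ; apply: complex_RVZ; apply: complex_RV_sum => y _. Qed.

Lemma sqn_mean_twisted n (Z : nat -> T -> R[i]) (u : nat -> R[i]) (C : \bar R) :
  (0 < n)%N -> (forall y, complex_RV (Z y)) -> (forall y, normc (u y) = 1) ->
  (forall y, (y < n)%N -> (sqn P (Z y) <= C)%E) ->
  (sqn P (fun w => mean n (fun y => Z y w * u y))%R <= C)%E.
Proof.
move=> n0 mZ u1 ZC; apply: sqn_mean => // [y _|y yn].
  by apply: complex_RVM => //; exact: complex_RV_cst.
under [X in sqn _ X]eq_fun do rewrite mulrC.
by rewrite sqnZ1//; exact: ZC.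
Qed.

End means_of_random_variables.

Section from_process_to_spectrum.
Context d (T : measurableType d) (R : realType) (P : probability T R) (p : nat)
  (H : R) (x : nat -> T -> R[i]).
Hypothesis p_prime : prime p.
Hypothesis H_gt0 : 0 < H.
Hypothesis x_RV : forall n, complex_RV (x n).
Hypothesis x0 : \forall w \ae P, x 0%N w = 0.
Hypothesis x1_L2 : (sqn P (x 1%N) < +oo)%E.
Hypothesis x_scaling : forall n, (0 < n)%N ->
  complex_eq_dist P (fun m => x (n * m)%N)
    (fun m w => Complex (scaling p H n) 0 * x m w).
Hypothesis x_increments : forall k, (0 < k)%N ->
  complex_eq_dist P (fun m w => x m.+1 w - x m w)
    (fun m w => x (m + k).+1 w - x (m + k)%N w).

Let pm_gt0 m : (0 < p ^ m)%N.
Proof. by rewrite expn_gt0 prime_gt0. Qed.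

(** Summing the stationary increments from 0 to n; the initial value [x 0]
    drops out since it vanishes almost surely. *)
Lemma shifted_law k : complex_eq_dist P x (fun n w => x (n + k)%N w - x k w).
Proof.
have [->|k0] := posnP k.
  apply: (complex_eq_dist_ae _ _ _ _ _ _
    (_ : complex_eq_dist P x x)) => //.
  - by move=> n; exact: complex_RVB.
  - by move=> n; apply: aeW.
  - by move=> n; apply: filterS x0 => w ->; rewrite addn0 subr0.
have := @complex_eq_dist_map _ T R P _ _ (fun (n : nat) (f : nat -> R[i]) =>
  \sum_(0 <= j < n) f j) _ _ _ (x_increments k0).
move=> /(_ (fun n => complex_RV_sum _ (fun j _ => complex_RV_entry j))) /= h.
apply: (complex_eq_dist_ae _ _ _ _ _ _ h) => //.
- by move=> n; apply: complex_RV_sum => j _; exact: complex_RVB.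
- by move=> n; apply: complex_RV_sum => j _; exact: complex_RVB.
- by move=> n; exact: complex_RVB.
- by move=> n; apply: filterS x0 => w w0; rewrite telescope_sumr// w0 subr0.
- move=> n; apply: aeW => w.
  by rewrite (telescope_sumr (fun j => x (j + k)%N w))//= add0n.
Qed.

Let K : R := fine (sqn P (x 1%N)).

Let x1E : sqn P (x 1%N) = K%:E.
Proof. by rewrite /K fineK// ge0_fin_numE ?sqn_ge0. Qed.

Let K_ge0 : 0 <= K.
Proof. exact/fine_ge0/sqn_ge0. Qed.

Lemma sqn_x n M : (p ^ M %| n)%N ->
  (sqn P (x n) <= (K * (ratio p H ^+ 2) ^+ M)%:E)%E.
Proof.
have rho0 : 0 <= ratio p H by rewrite ltW// ratio_gt0.
have [->|n0] := posnP n => Mn.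
  rewrite (sqn_ae (B := fun _ => 0) _ _ x0)//; last exact: complex_RV_cst.
  by rewrite sqn0 lee_fin mulr_ge0// exprn_ge0// sqr_ge0.
have -> : sqn P (x n) = ((scaling p H n) ^+ 2 * K)%:E.
  have := @sqn_eq_dist _ T R P _ (fun m => x (n * m)%N) _ 1%N _ _ (x_scaling n0).
  rewrite muln1 => ->//; last by move=> m; exact: complex_RVZ.
  by rewrite sqnZ// x1E -EFinM normc_sqr/= expr0n addr0.
rewrite lee_fin mulrC ler_wpM2l// exprAC.
apply: lerXn2r; rewrite ?nnegrE ?exprn_ge0 ?(ltW (scaling_gt0 _ _ _))//.
exact: scaling_le.
Qed.

Definition modulus (M : nat) : R := K * (ratio p H ^+ 2) ^+ M.

Lemma modulus_cvg0 : modulus @ \oo --> 0.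
Proof.
apply: cvg_geometric; rewrite ger0_norm ?sqr_ge0// expr_lt1//.
- exact: ratio_lt1.
- by rewrite ltW ?ratio_gt0.
Qed.

(** The p-adic Hoelder continuity of the process: the difference has the law of
    [x (y - z)], and p ^ M divides y - z. *)
Lemma sqn_close M y z : y = z %[mod p ^ M] ->
  (sqn P (fun w => x y w - x z w)%R <= (modulus M)%:E)%E.
Proof.
wlog zy : y z / (z <= y)%N.
  move=> W yz; have [zy|/ltnW yz'] := leqP z y; first exact: W.
  by rewrite sqn_subC//; exact: W.
move=> /eqP; rewrite eqn_mod_dvd// => yzM.
have := @sqn_eq_dist _ T R P _ _ _ (y - z)%N x_RV _ (shifted_law z).
move=> /(_ (fun n => complex_RVB (x_RV _) (x_RV _))).
by rewrite subnK// => <-; exact: sqn_x.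
Qed.

(** The approximation of order [N] of the Fourier coefficient of the process,
    seen as a function on Z_p, at the frequency l / p^m. *)
Definition fourier (N m l : nat) (w : T) : R[i] :=
  mean (p ^ N) (fun y => x y w * chibar R (p ^ m) l y).

Lemma fourier_RV N m l : complex_RV (fourier N m l).
Proof.
by apply: mean_RV => y; apply: complex_RVM => //; exact: complex_RV_cst.
Qed.

Lemma chibar_period m N l y : (m <= N)%N ->
  chibar R (p ^ m) l (y %% p ^ N) = chibar R (p ^ m) l y.
Proof. by move=> mN; rewrite /chibar -chi_modr// modn_dvdm ?chi_modr// dvdn_exp2l. Qed.

(** For m <= M <= N the average of order M is the average of order N of the
    process sampled at y mod p ^ M, which differs little from the process. *)
Lemma fourier_cauchy m l M N : (m <= M)%N -> (M <= N)%N ->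
  (sqn P (fun w => fourier N m l w - fourier M m l w)%R <= (modulus M)%:E)%E.
Proof.
move=> mM MN.
pose Z y w := x y w - x (y %% p ^ M)%N w.
rewrite (_ : (fun w => _) = (fun w => mean (p ^ N) (fun y =>
    Z y w * chibar R (p ^ m) l y))); last first.
  apply/funext => w.
  have -> : fourier M m l w = mean (p ^ N) (fun y =>
      x (y %% p ^ M)%N w * chibar R (p ^ m) l y).
    rewrite -(subnK MN) expnD mean_periodic// => [|y].
      by apply: eq_mean => y yM; rewrite modn_small.
    by rewrite modn_mod chibar_period.
  by rewrite meanB; apply: eq_mean => y _; rewrite mulrBl.
apply: sqn_mean_twisted => //.
- by move=> y; exact: complex_RVB.
- by move=> y; exact: normc_chibar.
- by move=> y _; apply: sqn_close; rewrite modn_mod.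
Qed.

Lemma fourier_limit m l : exists Y, complex_RV Y /\
  cvg_L2 P (fun N => fourier N m l) Y.
Proof.
apply: cvg_L2_complete => [N|e e0]; first exact: fourier_RV.
have /cvgrPdist_le/(_ _ e0)[M _ HM] := modulus_cvg0.
have small N : (M <= N)%N -> ((modulus N)%:E <= e%:E)%E.
  move=> MN; have := HM N MN; rewrite sub0r normrN lee_fin.
  exact/le_trans/ler_norm.
exists (maxn m M) => i j; rewrite !geq_max => /andP[mi Mi] /andP[mj Mj].
have [ij|/ltnW ji] := leqP i j.
  rewrite sqn_subC; [|exact: fourier_RV|exact: fourier_RV].
  exact: le_trans (fourier_cauchy _ mi ij) (small _ Mi).
exact: le_trans (fourier_cauchy _ mj ji) (small _ Mj).
Qed.

Variable A : nat -> nat -> T -> R[i].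
Hypothesis A_RV : forall m l, complex_RV (A m l).
Hypothesis A_limit : forall m l, cvg_L2 P (fun N => fourier N m l) (A m l).

(** The Fourier coefficient may be computed after a change of variable [phi]
    that permutes the residues modulo every p ^ N, by [sqn_close].  It is used for
    the translation by 1 and for the multiplication by [q]. *)
Lemma permuted_fourier_limit (phi : nat -> nat) m l :
  (forall N (F : nat -> R[i]),
     \sum_(0 <= y < p ^ N) F (phi y %% p ^ N)%N = \sum_(0 <= y < p ^ N) F y) ->
  cvg_L2 P (fun N w => mean (p ^ N) (fun y =>
    x (phi y) w * chibar R (p ^ m) l (phi y))) (A m l).
Proof.
move=> phi_perm.
pose D N w := mean (p ^ N) (fun y => (x (phi y) w - x (phi y %% p ^ N)%N w) *
  chibar R (p ^ m) l (phi y)).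
have mD N : complex_RV (D N).
  apply: mean_RV => y; apply: complex_RVM; last exact: complex_RV_cst.
  exact: complex_RVB.
have D0 : cvg_L2 P D (fun _ => 0).
  apply: (cvg_L2_le (N := 0%N) modulus_cvg0) => N _.
  under [X in sqn _ X]eq_fun do rewrite subr0.
  apply: sqn_mean_twisted => //.
  - by move=> y; exact: complex_RVB.
  - by move=> y; exact: normc_chibar.
  - by move=> y _; apply: sqn_close; rewrite modn_mod.
have := cvg_L2D mD (fun N => fourier_RV N m l) (@complex_RV_cst _ T R 0)
  (A_RV m l) D0 (A_limit m l).
under [X in cvg_L2 _ _ X -> _]eq_fun do rewrite add0r.
apply: (cvg_L2_eq (N := m)) => N mN; apply/funext => w.
have -> : fourier N m l w = mean (p ^ N) (fun y =>
    x (phi y %% p ^ N)%N w * chibar R (p ^ m) l (phi y)).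
  rewrite /fourier /mean -phi_perm; congr (_ * _).
  by apply: eq_bigr => y _; rewrite chibar_period.
by rewrite /D /mean -mulrDr -big_split/=; congr (_ * _); apply: eq_bigr => y _;
  rewrite -mulrDl subrK.
Qed.

Lemma mean_chibar m N l : (m <= N)%N -> valid_index p m l ->
  mean (p ^ N) (fun y => chibar R (p ^ m) l y) = 0.
Proof.
move=> mN /and4P[m0 l0 lp pl].
rewrite -(subnK mN) expnD mean_periodic// => [|y]; last by rewrite /chibar chi_modr.
rewrite /mean (_ : \sum_(0 <= y < _) _ = 0) ?mulr0//.
rewrite -[RHS](_ : (if 0%N == l %[mod p ^ m] then (p ^ m)%:R else 0) = 0); last first.
  by rewrite mod0n modn_small// eq_sym eqn0Ngt l0.
rewrite -sum_chi_chibar//; apply: eq_bigr => y _.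
by rewrite chi0 mul1r /chibar chi_sym.
Qed.

(** The counterpart of [eq_dist_expansion]: averages are measurable functionals
    of the process.  The weights [c] leave room for the choice of characters. *)
Lemma eq_dist_means (I : countType) (c : nat -> I -> nat -> R[i])
    (f g : nat -> T -> R[i]) (Y Z : I -> T -> R[i]) :
  (forall n, complex_RV (f n)) -> (forall n, complex_RV (g n)) ->
  complex_eq_dist P f g ->
  (forall i, complex_RV (Y i)) -> (forall i, complex_RV (Z i)) ->
  (forall i, cvg_L2 P
     (fun N w => mean (p ^ N) (fun y => f y w * c N i y)) (Y i)) ->
  (forall i, cvg_L2 P
     (fun N w => mean (p ^ N) (fun y => g y w * c N i y)) (Z i)) ->
  complex_eq_dist P Y Z.
Proof.
move=> mf mg fg mY mZ fY gZ.
apply: (eq_dist_cvg_L2 _ _ mY mZ fY gZ).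
- by move=> N i; apply: mean_RV => y; apply: complex_RVM => //; exact: complex_RV_cst.
- by move=> N i; apply: mean_RV => y; apply: complex_RVM => //; exact: complex_RV_cst.
apply: (complex_eq_dist_map (F := fun (k : nat * I) (h : nat -> R[i]) =>
  mean (p ^ k.1) (fun y => h y * c k.1 k.2 y)) _ fg) => k.
apply: complex_RVZ; apply: complex_RV_sum => y _.
by apply: complex_RVM; [exact: complex_RV_entry|exact: complex_RV_cst].
Qed.

(** The coefficients of x_{n+1} - x_1 are those of x rotated by e(l / p^m): the
    constant x_1 has no component on a nontrivial character. *)
Lemma spectrum_rotation : complex_eq_dist P (on_index p A)
  (on_index p (fun m l w => e_ (l%:R / (p ^ m)%:R : R) * A m l w)).
Proof.
pose c (N : nat) (i : spectral_index p) y :=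
  chibar R (p ^ (val i).1) (val i).2 y.
apply: (eq_dist_means (c := c) x_RV _ (shifted_law 1)).
- by move=> n; exact: complex_RVB.
- by move=> i; exact: A_RV.
- by move=> i; apply: complex_RVZ; exact: A_RV.
- by move=> i; exact: A_limit.
move=> [[m l] v].
have := permuted_fourier_limit (phi := succn) m l
  (fun N F => sum_succ_mod F (pm_gt0 N)).
move=> /(cvg_L2Z (e_ (l%:R / (p ^ m)%:R)) _ (A_RV m l)).
have mS N : complex_RV (fun w => mean (p ^ N) (fun y =>
    x y.+1 w * chibar R (p ^ m) l y.+1)).
  by apply: mean_RV => y; apply: complex_RVM => //; exact: complex_RV_cst.
move=> /(_ mS); apply: (cvg_L2_eq (N := m)) => N mN; apply/funext => w.
rewrite /c/=.
have -> : mean (p ^ N) (fun y => (x (y + 1)%N w - x 1%N w) *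
      chibar R (p ^ m) l y) =
    mean (p ^ N) (fun y => x y.+1 w * chibar R (p ^ m) l y) -
    x 1%N w * mean (p ^ N) (fun y => chibar R (p ^ m) l y).
  by rewrite meanZ meanB; apply: eq_mean => y _; rewrite addn1 mulrBl.
(* e(l / p^m) conj e((y + 1) l / p^m) = conj e(y l / p^m). *)
rewrite mean_chibar// mulr0 subr0 meanZ; apply: eq_mean => y _.
by rewrite mulrCA chibarS.
Qed.

(** The coefficient of x_{q n} at the frequency q l / p^m is that of x_n at
    l / p^m, by the change of variable y |-> q y. *)
Lemma spectrum_multiplication q : prime q -> q <> p ->
  complex_eq_dist P (on_index p A)
    (on_index p (fun m l => A m ((q * l) %% p ^ m)%N)).
Proof.
move=> pq qp; apply: complex_eq_dist_sym.
have xq : complex_eq_dist P x (fun n => x (q * n)%N).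
  apply: complex_eq_dist_sym; have := x_scaling (prime_gt0 pq).
  rewrite scaling_prime// (_ : (fun m w => Complex 1 0 * x m w) = x)//.
  by apply/funext => m; apply/funext => w; rewrite -[Complex 1 0]/(1 : R[i]) mul1r.
pose c (N : nat) (i : spectral_index p) y :=
  chibar R (p ^ (val i).1) ((q * (val i).2) %% p ^ (val i).1) y.
apply: (eq_dist_means (c := c) x_RV _ xq) => //.
- by move=> i; exact: A_RV.
- by move=> i; exact: A_RV.
- by move=> i; exact: A_limit.
move=> [[m l] v].
have := permuted_fourier_limit (phi := fun y => q * y)%N m l.
rewrite /c/=.
rewrite (_ : (fun N w => mean (p ^ N) (fun y => x (q * y)%N w *
      chibar R (p ^ m) ((q * l) %% p ^ m) y)) =
    (fun N w => mean (p ^ N) (fun y => x (q * y)%N w *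
      chibar R (p ^ m) l (q * y)))); last first.
  apply/funext => N; apply/funext => w; apply: eq_mean => y _.
  by rewrite /chibar chi_modl// -chi_mulr.
apply=> N F; apply: sum_mulmod => //.
have [->|N0] := posnP N; first by rewrite expn0 coprimen1.
by rewrite coprimeXr// prime_coprime// dvdn_prime2//; apply/eqP.
Qed.

(** Summing e(- y (t p^m + l) / p^(m+1)) over t < p annihilates the y that are
    not multiples of p: what remains is the coefficient of x_{p n} at l / p^m,
    already for finite averages. *)
Lemma spectrum_trace : complex_eq_dist P
  (on_index p (fun m l w => Complex (powR p%:R (- H)) 0 * A m l w))
  (on_index p (fun m l w => \sum_(0 <= t < p) A m.+1 (t * p ^ m + l)%N w)).
Proof.
apply: complex_eq_dist_sym.
have xp := x_scaling (prime_gt0 p_prime); rewrite scaling_p// in xp.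
pose c (N : nat) (i : spectral_index p) y :=
  chibar R (p ^ (val i).1) (val i).2 y.
apply: (eq_dist_means (c := c) _ _ xp) => //.
- by move=> n; exact: complex_RVZ.
- by move=> i; apply: complex_RV_sum => t _; exact: A_RV.
- by move=> i; apply: complex_RVZ; exact: A_RV.
- move=> [[m l] v]; rewrite /on_index/= /c/=.
  have := @cvg_L2_sum _ T R P _ (index_iota 0 p) xpredT
    (fun t N => fourier (N + 1) m.+1 (t * p ^ m + l))
    (fun t => A m.+1 (t * p ^ m + l)%N)
    (fun t N _ => fourier_RV _ _ _) (fun t _ => A_RV _ _)
    (fun t _ => cvg_L2_shift 1 (A_limit _ _)).
  rewrite (_ : (fun N w => \sum_(t <- _ | _) _) = (fun N w =>
    mean (p ^ N) (fun y => x (p * y)%N w * chibar R (p ^ m) l y)))//.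
  apply/funext => N; apply/funext => w; rewrite /fourier /mean -mulr_sumr.
  rewrite exchange_big/= addn1.
  (* Orthogonality of the characters of Z/pZ selects the multiples of p. *)
  have sum_t y : \sum_(0 <= t < p) x y w *
        chibar R (p ^ m.+1) (t * p ^ m + l) y =
      if (p %| y)%N then p%:R * (x y w * chibar R (p ^ m.+1) l y) else 0.
    transitivity (x y w * chibar R (p ^ m.+1) l y *
        (\sum_(0 <= t < p) chi R p t 0 * chibar R p t y)).
      rewrite mulr_sumr; apply: eq_bigr => t _; rewrite -mulrA; congr (_ * _).
      rewrite chi0 mul1r chibarDl mulrC; congr (_ * _).
      by rewrite /chibar expnS chi_scale.
    rewrite sum_chi_chibar ?prime_gt0// mod0n eq_sym -/(p %| y)%N.
    by case: ifP => _; rewrite ?mulr0// mulrC.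
  under eq_bigr do rewrite sum_t.
  rewrite -big_mkcond/= expnSr sum_dvd ?prime_gt0// natrM invfM -mulr_sumr mulrA.
  congr (_ * _).
    by rewrite mulrVK// ?unitfE natrC_neq0// prime_gt0.
  apply: eq_bigr => j _; rewrite mulnC; congr (_ * _).
  by rewrite /chibar expnSr chi_scaler// prime_gt0.
- move=> [[m l] v]; rewrite /on_index/= /c/=.
  have := cvg_L2Z (Complex (powR p%:R (- H)) 0)
    (fun N => fourier_RV N m l) (A_RV m l) (A_limit m l).
  rewrite (_ : (fun N w => _ * fourier N m l w) = (fun N w =>
    mean (p ^ N) (fun y => Complex (powR p%:R (- H)) 0 * x y w *
      chibar R (p ^ m) l y)))//.
  apply/funext => N; apply/funext => w; rewrite meanZ.
  by apply: eq_mean => y _; rewrite mulrA.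
Qed.

Lemma spectrum_L2 m l : (sqn P (A m l) < +oo)%E.
Proof.
rewrite (_ : A m l = (fun w => A m l w - 0)); last first.
  by apply/funext => w; rewrite subr0.
apply: (@le_lt_trans _ _ (2 * modulus 0)%:E); last exact: ltry.
apply: (sqn_cvg_le (S := fun N => fourier N m l) (N := 0%N)) => //.
- by move=> N; exact: fourier_RV.
- exact: complex_RV_cst.
move=> N _; under [X in sqn P X]eq_fun do rewrite subr0.
apply: sqn_mean_twisted => //.
- by move=> y; exact: normc_chibar.
- by move=> y _; apply: sqn_x; rewrite expn0 dvd1n.
Qed.

(** By the rotation invariance, E (A_i conj A_j) = e(u_i - u_j) E (A_i conj A_j),
    where the frequencies u_i and u_j are distinct points of [0, 1). *)
Lemma spectrum_orthogonal : orthogonal_L2 P (on_index p A).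
Proof.
split=> [i|i j ij].
  by split; [exact: A_RV|rewrite sqnE; exact: spectrum_L2].
pose Y (k : spectral_index p) := on_index p A k.
pose u (k : spectral_index p) : R := (val k).2%:R / (p ^ (val k).1)%:R.
have mY k : complex_RV (Y k) by exact: A_RV.
have := complex_expectation_eq_dist i j mY _ spectrum_rotation.
move=> /(_ (fun k => complex_RVZ _ (mY k))).
rewrite -/(Y i) -/(Y j) -/(Y i) -/(Y j).
set E := complex_expectation P _.
rewrite (_ : complex_expectation P _ = e_ (u i - u j) * E); last first.
  rewrite /E -complex_expectationZ.
  - congr complex_expectation; apply/funext => w.
    rewrite /on_index -/(u i) -/(u j) -/(Y i w) -/(Y j w) conjcM mulrACA.
    by rewrite conjc_e -e_D.
  - apply: (integrable_product (f := @complex.Re R)) => //; try exact: spectrum_L2.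
      by have /complex_RVP[] := complex_RVM (mY i) (complex_RV_conj (mY j)).
    exact: normc_Re.
  - apply: (integrable_product (f := @complex.Im R)) => //; try exact: spectrum_L2.
      by have /complex_RVP[] := complex_RVM (mY i) (complex_RV_conj (mY j)).
    exact: normc_Im.
have c1 : e_ (u i - u j) != 1.
  have ubd k : 0 <= u k < 1.
    have /and4P[_ _ lp _] := valP k.
    by rewrite /u divr_ge0//= ltr_pdivrMr ?ltr0n// mul1r ltr_nat.
  apply/negP => /eqP; rewrite e_D e_N => h.
  have e0 : e_ (u j) != 0.
    by apply/negP => /eqP e0; move/eqP: h; rewrite e0 invr0 mulr0 eq_sym oner_eq0.
  have {}h : e_ (u i) = e_ (u j) by rewrite -[LHS](mulfVK e0) h mul1r.
  apply: ij; apply/val_inj; move/(e_inj (ubd i) (ubd j)): h.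
  move/(index_frequency_inj p_prime (valP i) (valP j)).
  by rewrite -!surjective_pairing.
move=> /eqP; rewrite -subr_eq0 -{1}[E]mul1r -mulrBl mulf_eq0 subr_eq0 eq_sym.
by rewrite (negPf c1) => /eqP.
Qed.

(** Summing the characters of level at most M gives p ^ M times the indicator
    of the residue class of [n]: the partial sum is the average over the class of
    [n] modulo p ^ M minus the average over the class of 0. *)
Lemma fourier_inversion n M N w : (M <= N)%N ->
  \sum_(1 <= m < M.+1) \sum_(1 <= l < p ^ m | ~~ (p %| l)%N)
     fourier N m l w * (chi R (p ^ m) l n - 1) =
  mean (p ^ (N - M)) (fun j => x (j * p ^ M + n %% p ^ M)%N w) -
  mean (p ^ (N - M)) (fun j => x (j * p ^ M)%N w).
Proof.
move=> MN.
pose g m l := fourier N m l w * (chi R (p ^ m) l n - 1).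
have gp m l : g m.+1 (l * p)%N = g m l.
  rewrite /g expnSr chi_scale ?prime_gt0//; congr (_ * _).
  by apply: eq_mean => y _; rewrite expnSr /chibar chi_scale ?prime_gt0.
have := sum_levels M (prime_gt0 p_prime) gp.
rewrite [g 0%N 0%N]/g chi_0l subrr mulr0 add0r => <-.
(* Used for z = n and, all characters being 1 at 0, for z = 0. *)
have inner z : \sum_(0 <= k < p ^ M) fourier N M k w * chi R (p ^ M) k z =
    mean (p ^ (N - M)) (fun j => x (j * p ^ M + z %% p ^ M)%N w).
  rewrite /fourier {1}/mean.
  under eq_bigr do rewrite -mulrA mulr_suml.
  rewrite -mulr_sumr exchange_big/=.
  have inner_y y : \sum_(0 <= k < p ^ M)
        x y w * chibar R (p ^ M) k y * chi R (p ^ M) k z =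
      if y == z %[mod p ^ M] then (p ^ M)%:R * x y w else 0.
    under eq_bigr => k _ do rewrite -mulrA [chibar _ _ _ _ * _]mulrC.
    rewrite -mulr_sumr sum_chi_chibar// eq_sym.
    by case: ifP => _; rewrite ?mulr0// mulrC.
  under eq_bigr do rewrite inner_y.
  rewrite -{1 2}(subnK MN) expnD sum_nat_mul natrM invfM -mulrA; congr (_ * _).
  rewrite mulr_sumr; apply: eq_bigr => j _.
  rewrite -big_mkcond/= big_mkord.
  rewrite (eq_bigl (fun r : 'I_(p ^ M) => r == Ordinal (ltn_pmod z (pm_gt0 M)))).
    by rewrite big_pred1_eq mulKf// natrC_neq0.
  by move=> r; rewrite modnMDl modn_small.
under eq_bigr do rewrite /g mulrBr mulr1.
rewrite sumrB inner; congr (_ - _).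
transitivity (\sum_(0 <= k < p ^ M) fourier N M k w * chi R (p ^ M) k 0).
  by apply: eq_bigr => k _; rewrite chi0 mulr1.
by rewrite inner mod0n; apply: eq_mean => j _; rewrite addn0.
Qed.

(** Both averages of [fourier_inversion] are close to the values at [n] and at
    0, uniformly in the order N of the averages; let N tend to infinity first. *)
Lemma process_expansion n : cvg_L2 P (partial_expansion p A n) (x n).
Proof.
pose S M N w := \sum_(1 <= m < M.+1) \sum_(1 <= l < p ^ m | ~~ (p %| l)%N)
     fourier N m l w * (chi R (p ^ m) l n - 1).
have mterm (B : T -> R[i]) (e : R[i]) : complex_RV B -> complex_RV (fun w => B w * e).
  by move=> mB; apply: complex_RVM => //; exact: complex_RV_cst.
have mS M N : complex_RV (S M N).
  by apply: complex_RV_level_sum => m l _; apply: mterm; exact: fourier_RV.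
have mE M : complex_RV (partial_expansion p A n M).
  by apply: complex_RV_level_sum => m l _; apply: mterm; exact: A_RV.
have S_cvg M : cvg_L2 P (S M) (partial_expansion p A n M).
  apply: cvg_L2_sum => [m N _|m _|m _].
  - by apply: complex_RV_sum => l _; apply: mterm; exact: fourier_RV.
  - by apply: complex_RV_sum => l _; apply: mterm; exact: A_RV.
  - apply: cvg_L2_sum => [l N _|l _|l _].
    + by apply: mterm; exact: fourier_RV.
    + by apply: mterm; exact: A_RV.
    + rewrite (_ : (fun N w => fourier N m l w * _) = (fun N w =>
        (chi R (p ^ m) l n - 1) * fourier N m l w)); last first.
        by apply/funext => N; apply/funext => w; rewrite mulrC.
      rewrite (_ : (fun w => A m l w * _) = (fun w =>
        (chi R (p ^ m) l n - 1) * A m l w)); last first.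
        by apply/funext => w; rewrite mulrC.
      by apply: cvg_L2Z => // N; exact: fourier_RV.
have S_close M N : (M <= N)%N ->
    (sqn P (fun w => S M N w - x n w)%R <= (4 * modulus M)%:E)%E.
  move=> MN.
  pose D z w := mean (p ^ (N - M)) (fun j =>
    (x (j * p ^ M + z %% p ^ M)%N w - x z w) * 1).
  have mD z : complex_RV (D z).
    by apply: mean_RV => y; apply: mterm; exact: complex_RVB.
  have D_small z : (sqn P (D z) <= (modulus M)%:E)%E.
    apply: sqn_mean_twisted => //.
    - by move=> y; exact: complex_RVB.
    - by move=> y; exact: normc1.
    - by move=> y _; apply: sqn_close; rewrite modnMDl modn_mod.
  (* [D z] is the average over the class of z, minus the value at z. *)
  have SE w : S M N w - x n w = D n w - D 0%N w - x 0%N w.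
    rewrite /S fourier_inversion//.
    have DE z : D z w = mean (p ^ (N - M)) (fun j => x (j * p ^ M + z %% p ^ M)%N w)
        - x z w.
      rewrite -[in RHS](mean_cst (x z w) (pm_gt0 (N - M))) meanB.
      by apply: eq_mean => j _; rewrite mulr1.
    rewrite !DE mod0n.
    have -> : mean (p ^ (N - M)) (fun j => x (j * p ^ M + 0)%N w) =
        mean (p ^ (N - M)) (fun j => x (j * p ^ M)%N w).
      by apply: eq_mean => j _; rewrite addn0.
    by ring.
  rewrite (sqn_ae (B := fun w => D n w + (- 1) * D 0%N w)); last first.
  - by apply: filterS x0 => w w0; rewrite SE w0 subr0 mulN1r.
  - by apply: complex_RVD => //; exact: complex_RVZ.
  - exact: complex_RVB.
  apply: le_trans (sqnD P (mD n) (complex_RVZ _ (mD 0%N))) _.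
  have n1 : normc (- 1 : R[i]) = 1 by rewrite normcN normc1.
  rewrite (sqnZ1 P (mD 0%N) n1).
  have -> : (4 * modulus M)%:E = (2%:E * (modulus M)%:E + 2%:E * (modulus M)%:E)%E.
    by rewrite -!EFinM -EFinD; congr (_%:E); ring.
  by apply: leeD; apply: lee_wpmul2l.
apply: (@cvg_L2_le _ T R P _ _ (fun M => 2 * (4 * modulus M)) 0%N).
  rewrite -[X in _ --> X](mulr0 (2 * 4)).
  under eq_fun do rewrite mulrA.
  by apply: cvgM; [exact: cvg_cst|exact: modulus_cvg0].
move=> M _; apply: (sqn_cvg_le (S := S M) (N := M)) => //; exact: S_close.
Qed.

End from_process_to_spectrum.

(** * The characterization *)

Unset Implicit Arguments.

Theorem theorem5p1 (R : realType) (d : measure_display) (T : measurableType d)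
    (P : probability T R) (p : nat) (H : R) (X : nat -> {RV P >-> R})
    (p_prime : prime p) (H_gt0 : 0 < H)
    (X1_L2 : ('E_P[fun w => (`|X 1%N w| ^+ 2)%R] < +oo)%E) :
  dt_ss_si P (fun n => powR (padic_norm R p n) H) X <->
  exists A : nat -> nat -> T -> R[i],
    orthogonal_L2 P (on_index p A) /\
    (forall n : nat,
       cvg_L2 P (partial_expansion p A n) (fun w => Complex (X n w) 0)) /\
    complex_eq_dist P
      (on_index p A)
      (on_index p (fun m l w => e_ (l%:R / (p ^ m)%:R : R) * A m l w)) /\
    (forall q : nat, prime q -> q <> p ->
       complex_eq_dist P
         (on_index p A)
         (on_index p (fun m l => A m ((q * l) %% p ^ m)%N))) /\
    complex_eq_dist P
      (on_index p (fun m l w => Complex (powR p%:R (- H)) 0 * A m l w))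
      (on_index p (fun m l w =>
         \sum_(0 <= t < p) A m.+1 (t * p ^ m + l)%N w)).
Proof.
pose x n w := Complex (X n w) 0 : R[i].
have x_RV n : complex_RV (x n) by exact: complex_RV_real.
have scaledE n : (fun m w => Complex (scaling p H n) 0 * x m w) =
    (fun m w => Complex (scaling p H n * X m w) 0).
  apply/funext => m; apply/funext => w; apply/eqP.
  by rewrite eq_complex/= !mulr0 mul0r subr0 addr0 !eqxx.
have incrE (u v : nat -> nat) : (fun n w => x (u n) w - x (v n) w) =
    (fun n w => Complex (X (u n) w - X (v n) w) 0).
  apply/funext => n; apply/funext => w; apply/eqP.
  by rewrite eq_complex/= subr0 !eqxx.
split=> [[_ X_ss X_si]|[A [[A_L2 _] [A_exp [A_rot [A_mul A_tr]]]]]]; last first.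
  have A_RV i : complex_RV (on_index p A i) by have [] := A_L2 i.
  split=> [n _|n n0|k _].
  - exact: scaling_gt0.
  - apply/complex_eq_distP; rewrite -scaledE.
    exact: (scaling_of_spectrum p_prime A_RV A_exp A_mul A_tr n0).
  - exact: (stationary_increments_of_spectrum A_RV A_exp A_rot).
have x_scaling n : (0 < n)%N -> complex_eq_dist P (fun m => x (n * m)%N)
    (fun m w => Complex (scaling p H n) 0 * x m w).
  by move=> /X_ss/complex_eq_distP; rewrite scaledE.
have x_increments k : (0 < k)%N ->
    complex_eq_dist P (fun m w => x m.+1 w - x m w)
      (fun m w => x (m + k).+1 w - x (m + k)%N w).
  move=> /X_si/complex_eq_distP; rewrite (incrE succn id).
  by rewrite (incrE (fun m => (m + k).+1) (fun m => m + k)%N).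
have x0 : \forall w \ae P, x 0%N w = 0.
  have X0 : \forall w \ae P, X 0%N w = 0.
    apply: (contracting_law_ae0 (r := ratio p H)) => //.
      by rewrite ratio_gt0//= ratio_lt1.
    move=> k B mB.
    have pk0 : (0 < p ^ k)%N by rewrite expn_gt0 prime_gt0.
    have := X_ss _ pk0 [set f | B (f 0%N)].
    rewrite /= muln0 -/(scaling p H (p ^ k)) scalingE// pfactorK//; apply.
    by apply: sub_sigma_algebra; exists 0%N, B.
  by apply: filterS X0 => w; rewrite /x => ->.
have x1_L2 : (sqn P (x 1%N) < +oo)%E.
  rewrite -sqnE; apply: le_lt_trans X1_L2; rewrite unlock.
  rewrite le_eqVlt; apply/orP; left; apply/eqP; apply: eq_integral => w _.
  by rewrite normc_sqr/= expr0n addr0 real_normK ?num_real.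
have /choice[A0 A0P] : forall ml : nat * nat, exists Y, complex_RV Y /\
    cvg_L2 P (fun N => fourier p x N ml.1 ml.2) Y.
  by move=> ml; exact: (fourier_limit p_prime H_gt0 x_RV x0 x1_L2 x_scaling x_increments).
pose A m l := A0 (m, l).
have A_RV m l : complex_RV (A m l) by have [] := A0P (m, l).
have A_limit m l : cvg_L2 P (fun N => fourier p x N m l) (A m l).
  by have [] := A0P (m, l).
exists A; split.
  exact: (spectrum_orthogonal p_prime H_gt0 x_RV x0 x1_L2 x_scaling x_increments A_RV A_limit).
split; first by move=> n; exact: (process_expansion p_prime H_gt0 x_RV x0 x1_L2
    x_scaling x_increments A_RV A_limit).
split; first exact: (spectrum_rotation p_prime H_gt0 x_RV x0 x1_L2
    x_scaling x_increments A_RV A_limit).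
split; first by move=> q; exact: (spectrum_multiplication p_prime H_gt0 x_RV x0 x1_L2
    x_scaling x_increments A_RV A_limit).
exact: (spectrum_trace p_prime x_RV x_scaling A_RV A_limit).
Qed.
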